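(* Consider the nonconvex-strongly-concave minimax problem with the standing assumptions and the semi-shuffling variant of Algorithm 2 described in the context. Let $\Lambda_0\ge1$, $\Lambda_1\ge0$ be such that, for the step size $\eta$ used, $\|\nabla\Phi_0(w)\|^2\le\Lambda_0\|\mathcal{G}_\eta(w)\|^2+\Lambda_1$ for all $w$. Fix $\hat\eta\in\big(0,\frac{2}{L_u+\mu_H}\big]$. Then there exist a positive integer $S=\mathcal{O}\Big(\frac1{\hat\eta}\big(\mu_h+\frac{4L_u\mu_H}{L_u+\mu_H}\big)^{-1}\Big)=\mathcal{O}(1)$ (independent of $\epsilon$ and $n$) and positive constants $c,C$ (independent of $\epsilon$ and $n$, depending only on $L_w,L_u,\mu_H,\mu_h,\Theta_w,\sigma_w,\Lambda_0,\Lambda_1,\hat\eta$, $\Psi_0(\widetilde w_0)-\Psi_0^\star$ and $\|\widetilde u_0-u_0^*(\widetilde w_0)\|$) such that, for every sufficiently small $\epsilon>0$: if $\{(\widetilde w_t,\widetilde u_t)\}$ is generated by the semi-shuffling variant with $S$ gradient ascent iterations per epoch, step sizes $\eta_t=\eta:=c\,\epsilon$ and $\hat\eta_t=\hat\eta$, arbitrary permutations $\hat\pi^{(t)}$, and $T:=\lceil C\epsilon^{-3}\rceil$ epochs, then $$\frac1{T+1}\sum_{t=0}^T\|\mathcal{G}_\eta(\widetilde w_t)\|^2\le\epsilon^2 .$$ Consequently, the algorithm requires $\mathcal{O}(n\epsilon^{-3})$ evaluations of both $\nabla_w\mathcal{H}_i$ and $\nabla_u\mathcal{H}_i$ to achieve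 an $\epsilon$-stationary point $\widehat w_T$ of $\min_w\Psi_0(w)$, i.e. $\mathbb{E}[\|\mathcal{G}_\eta(\widehat w_T)\|^2]\le\epsilon^2$.
   Context: Problem: $\min_{w\in\mathbb{R}^p}\max_{u\in\mathbb{R}^q}\{\mathcal{L}(w,u):=f(w)+\mathcal{H}(w,u)-h(u)\}$, $\mathcal{H}:=\frac1n\sum_{i=1}^n\mathcal{H}_i$, with $\mathcal{H}_i:\mathbb{R}^p\times\mathbb{R}^q\to\mathbb{R}$ differentiable and $f,h$ proper, closed, convex with values in $\mathbb{R}\cup\{+\infty\}$. Assumptions: $h$ is $\mu_h$-strongly convex, $\mu_h\ge0$, with bounded domain. For each $i$: $\mathcal{H}_i(w,\cdot)$ is $\mu_H$-strongly concave for every $w$, $\mu_H\ge0$, and $\mu_H+\mu_h>0$; $\|\nabla\mathcal{H}_i(w,u)-\nabla\mathcal{H}_i(\hat w,\hat u)\|^2\le L_w^2\|w-\hat w\|^2+L_u^2\|u-\hat u\|^2$. There are $\Theta_w,\sigma_w,\Theta_u,\sigma_u\ge0$ with $\frac1n\sum_i\|\nabla_w\mathcal{H}_i-\nabla_w\mathcal{H}\|^2\le\Theta_w\|\nabla_w\mathcal{H}\|^2+\sigma_w^2$ and $\frac1n\sum_i\|\nabla_u\mathcal{H}_i-\nabla_u\mathcal{H}\|^2\le\Theta_u\|\nabla_u\mathcal{H}\|^2+\sigma_u^2$ at every $(w,u)$. $\Phi_0(w):=\max_u\{\mathcal{H}(w,u)-h(u)\}$ with unique maximizer $u_0^*(w)$,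 $\nabla\Phi_0(w)=\nabla_w\mathcal{H}(w,u_0^*(w))$, $\Psi_0:=f+\Phi_0$, $\Psi_0^\star:=\inf\Psi_0>-\infty$. Gradient mapping: $\mathcal{G}_\eta(w):=\eta^{-1}\big(w-\mathrm{prox}_{\eta f}(w-\eta\nabla\Phi_0(w))\big)$, where $\mathrm{prox}_{\eta f}(w)=\arg\min_v\{f(v)+\frac1{2\eta}\|v-w\|^2\}$. Algorithm 2 (semi-shuffling variant): start from $(\widetilde w_0,\widetilde u_0)\in\mathrm{dom}(\mathcal{L})$. At epoch $t=1,\dots,T$: (1) set $\widehat u_0^{(t)}:=\widetilde u_{t-1}$; for $s=1,\dots,S$: $\widehat u_s^{(t)}:=\mathrm{prox}_{\hat\eta_th}\big(\widehat u_{s-1}^{(t)}+\frac{\hat\eta_t}{n}\sum_{i=1}^n\nabla_u\mathcal{H}_i(\widetilde w_{t-1},\widehat u_{s-1}^{(t)})\big)$; set $\widetilde u_t:=\widehat u_S^{(t)}$. (2) Set $w_0^{(t)}:=\widetilde w_{t-1}$, generate a permutation $\hat\pi^{(t)}$ of $\{1,\dots,n\}$; for $i=1,\dots,n$: $w_i^{(t)}:=w_{i-1}^{(t)}-\frac{\eta_t}n\nabla_w\mathcal{H}_{\hat\pi^{(t)}(i)}(w_{i-1}^{(t)},\widetilde u_t)$; set $\widetilde w_t:=\mathrm{prox}_{\eta_tf}(w_n^{(t)})$. Output: $\widehat w_T:=\widetilde w_{t_*}$, where either $t_*\in\arg\min_{0\le t\le T}\|\mathcal{G}_\eta(\widetilde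 w_t)\|$ or $t_*$ is uniformly random in $\{0,\dots,T\}$. *)

(* Defs.v *)
(* MathComp-Analysis: R is an abstract realType and R^p is 'rV[R]_p. *)
From HB Require Import structures.
From mathcomp Require Import all_boot all_order all_algebra all_fingroup.
From mathcomp Require Import all_classical all_reals all_analysis.
Set Implicit Arguments.
Unset Strict Implicit.
Unset Printing Implicit Defensive.
Import Order.TTheory GRing.Theory Num.Theory numFieldNormedType.Exports.
Local Open Scope classical_set_scope.
Local Open Scope ring_scope.

Section Preliminaries.
Context {R : realType}.

(* The library norm of 'rV[R]_p is the sup norm; it induces the same topology,
   boundedness and differentiability as the Euclidean norm below. *)
Definition enorm p (x : 'rV[R]_p) : R := Num.sqrt (\sum_(i < p) x 0 i ^+ 2).

Definition grad p (F : 'rV[R]_p -> R) (x : 'rV[R]_p) : 'rV[R]_p :=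
  \row_(i < p) 'D_(delta_mx 0 i) F x.

Definition gradw p q (F : 'rV[R]_p * 'rV[R]_q -> R) (w : 'rV[R]_p)
    (u : 'rV[R]_q) : 'rV[R]_p :=
  grad (fun w' => F (w', u)) w.

Definition gradu p q (F : 'rV[R]_p * 'rV[R]_q -> R) (w : 'rV[R]_p)
    (u : 'rV[R]_q) : 'rV[R]_q :=
  grad (fun u' => F (w, u')) u.

Definition edom p (g : 'rV[R]_p -> \bar R) : set 'rV[R]_p :=
  [set x | (g x < +oo)%E].

Definition proper_fun p (g : 'rV[R]_p -> \bar R) : Prop :=
  (forall x, g x <> -oo%E) /\ edom g !=set0.

Definition closed_fun p (g : 'rV[R]_p -> \bar R) : Prop :=
  closed [set z : 'rV[R]_p * R | (g z.1 <= z.2%:E)%E].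

(* For functions with values in R u {+oo}; note 0 * +oo = 0 in \bar R. *)
Definition convex_fun p (g : 'rV[R]_p -> \bar R) : Prop :=
  forall (x y : 'rV[R]_p) (t : R), 0 <= t <= 1 ->
    (g (t *: x + (1 - t) *: y)%R <= t%:E * g x + (1 - t)%:E * g y)%E.

Definition strongly_convex p (mu : R) (g : 'rV[R]_p -> \bar R) : Prop :=
  convex_fun (fun x => (g x - (mu / 2 * enorm x ^+ 2)%:E)%E).

Definition strongly_concave p (mu : R) (g : 'rV[R]_p -> R) : Prop :=
  strongly_convex mu (fun x => (- g x)%:E).

(* prox eta g w is prox_{eta g}(w); the minimizer is picked by choice. *)
Definition prox p (eta : R) (g : 'rV[R]_p -> \bar R) (w : 'rV[R]_p)
    : 'rV[R]_p :=
  get [set v | forall v' : 'rV[R]_p,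
    (g v + ((2 * eta)^-1 * enorm (v - w) ^+ 2)%:E
       <= g v' + ((2 * eta)^-1 * enorm (v' - w) ^+ 2)%:E)%E].

End Preliminaries.

Record minimax (R : realType) (n p q : nat) := Minimax {
  mf : 'rV[R]_p -> \bar R;
  mh : 'rV[R]_q -> \bar R;
  mHi : 'I_n -> 'rV[R]_p * 'rV[R]_q -> R }.

Section Problem.
Context {R : realType} {n p q : nat} (Q : minimax R n p q).

Definition mH (z : 'rV[R]_p * 'rV[R]_q) : R := n%:R^-1 * \sum_(i < n) mHi Q i z.

Definition Phi0 (w : 'rV[R]_p) : \bar R :=
  ereal_sup (range (fun u : 'rV[R]_q => ((mH (w, u))%:E - mh Q u)%E)).

Definition u0star (w : 'rV[R]_p) : 'rV[R]_q :=
  get [set u | forall u' : 'rV[R]_q,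
    ((mH (w, u'))%:E - mh Q u' <= (mH (w, u))%:E - mh Q u)%E].

(* The genuine gradient of Phi0, not the formula gradw mH w (u0star w). *)
Definition gradPhi0 (w : 'rV[R]_p) : 'rV[R]_p := grad (fun w' => fine (Phi0 w')) w.

Definition Psi0 (w : 'rV[R]_p) : \bar R := (mf Q w + Phi0 w)%E.

Definition Psi0star : \bar R := ereal_inf (range Psi0).

Definition gradmap (eta : R) (w : 'rV[R]_p) : 'rV[R]_p :=
  eta^-1 *: (w - prox eta (mf Q) (w - eta *: gradPhi0 w)).

Record standing_assumptions (Lw Lu muH muh Thw sgw Thu sgu : R) : Prop := {
  sa_n : (0 < n)%N;
  sa_f : [/\ proper_fun (mf Q), closed_fun (mf Q) & convex_fun (mf Q)];
  sa_h : [/\ proper_fun (mh Q), closed_fun (mh Q) & convex_fun (mh Q)];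
  sa_h_strong : strongly_convex muh (mh Q);
  sa_h_bounded : bounded_set (edom (mh Q));
  sa_H_diff : forall (i : 'I_n) (z : 'rV[R]_p * 'rV[R]_q),
    differentiable (mHi Q i) z;
  sa_H_concave : forall (i : 'I_n) (w : 'rV[R]_p),
    strongly_concave muH (fun u => mHi Q i (w, u));
  sa_H_smooth : forall (i : 'I_n) (w w' : 'rV[R]_p) (u u' : 'rV[R]_q),
    enorm (gradw (mHi Q i) w u - gradw (mHi Q i) w' u') ^+ 2
    + enorm (gradu (mHi Q i) w u - gradu (mHi Q i) w' u') ^+ 2
    <= Lw ^+ 2 * enorm (w - w') ^+ 2 + Lu ^+ 2 * enorm (u - u') ^+ 2;
  sa_var_w : forall (w : 'rV[R]_p) (u : 'rV[R]_q),
    n%:R^-1 * \sum_(i < n) enorm (gradw (mHi Q i) w u - gradw mH w u) ^+ 2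
    <= Thw * enorm (gradw mH w u) ^+ 2 + sgw ^+ 2;
  sa_var_u : forall (w : 'rV[R]_p) (u : 'rV[R]_q),
    n%:R^-1 * \sum_(i < n) enorm (gradu (mHi Q i) w u - gradu mH w u) ^+ 2
    <= Thu * enorm (gradu mH w u) ^+ 2 + sgu ^+ 2;
  sa_Psi0 : (-oo < Psi0star)%E }.

(* evw and evu count the evaluations made so far of the partial gradients
   gradw (mHi Q i) and gradu (mHi Q i), one for each index i queried. *)
Record state := State {
  wt : 'rV[R]_p;
  ut : 'rV[R]_q;
  evw : nat;
  evu : nat }.

Definition ascent_step (etah : R) (w : 'rV[R]_p) (s : 'rV[R]_q * nat)
    : 'rV[R]_q * nat :=
  (prox etah (mh Q)
     (s.1 + (etah / n%:R) *: \sum_(i < n) gradu (mHi Q i) w s.1),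
   (s.2 + n)%N).

Definition descent_step (eta : R) (u : 'rV[R]_q) (s : 'rV[R]_p * nat)
    (i : 'I_n) : 'rV[R]_p * nat :=
  (s.1 - (eta / n%:R) *: gradw (mHi Q i) s.1 u, s.2.+1).

Definition epoch (S : nat) (eta etah : R) (pi : 'S_n) (s : state) : state :=
  let: (u', ku) := iter S (ascent_step etah (wt s)) (ut s, evu s) in
  let: (w', kw) :=
    foldl (descent_step eta u') (wt s, evw s) [seq pi i | i <- enum 'I_n] in
  State (prox eta (mf Q) w') u' kw ku.

(* run ... t is the state after t epochs; epoch t uses eta t, etah t, pi t
   (t >= 1). *)
Fixpoint run (S : nat) (eta etah : nat -> R) (pi : nat -> 'S_n)
    (w0 : 'rV[R]_p) (u0 : 'rV[R]_q) (t : nat) : state :=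
  if t is t'.+1 then
    epoch S (eta t) (etah t) (pi t) (run S eta etah pi w0 u0 t')
  else State w0 u0 0 0.

End Problem.

(* The index t_* of the returned iterate, as a random variable: either a
   minimizer of v over {0, ..., T}, or uniform on {0, ..., T}. *)
Definition output_rule (R : realType) (d : measure_display)
    (Omega : measurableType d) (P : probability Omega R) (T : nat)
    (v : nat -> R) (tstar : Omega -> nat) : Prop :=
  measurable_fun setT tstar /\
  ((forall om, (tstar om <= T)%N /\
      forall t, (t <= T)%N -> v (tstar om) <= v t) \/
   (forall t, (t <= T)%N ->
      P [set om | tstar om = t] = ((T.+1%:R : R)^-1)%:E)).

(* Main.v *)
(** One inner ascent step per epoch is enough.  The map
    [u |-> prox (u + etah * gradu H w u)] contracts towards [u0star w] with a
    rate [rho < 1] depending only on [muH], [muh], [etah]; hence [S = 1], and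
    the bound on [S] holds with [K = 1].  The same contraction shows that
    [u0star] is Lipschitz, so that [Phi0] is differentiable with gradient
    [gradw H w (u0star w)] and has a quadratic upper model (Danskin).

    Whatever the permutation, the shuffled pass differs from one gradient step
    on [Phi0] by [eta * e] with
    [e ^ 2 = O (eta ^ 2 (|G| ^ 2 + 1) + |u - u0star w| ^ 2)].  The proximal
    gradient step decreases [Psi0] by a multiple of
    [eta |G| ^ 2 + |w' - w| ^ 2 / eta], up to [O (eta e ^ 2)].  Both lag terms
    are absorbed by the Lyapunov function
    [Psi0 w + eta * lambda * |u - u0star w| ^ 2], because
    [|u - u0star w| ^ 2] shrinks by [rho] in each epoch up to a multiple of
    [|w' - w| ^ 2].  Summation over [O (eps ^ -3)] epochs with
    [eta = c * eps] gives the rate. *)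
Require Import Defs.
From HB Require Import structures.
From mathcomp Require Import all_boot all_order all_algebra all_fingroup.
From mathcomp Require Import all_classical all_reals all_analysis.
From mathcomp Require Import measurable_realfun.
From mathcomp Require Import ring lra.
Set Implicit Arguments.
Unset Strict Implicit.
Unset Printing Implicit Defensive.
Import Order.TTheory GRing.Theory Num.Theory numFieldNormedType.Exports.
Local Open Scope classical_set_scope.
Local Open Scope ring_scope.

(** * Euclidean inner product and norm *)

Section Euclidean.
Context {R : realType} {p : nat}.
Implicit Types (x y z : 'rV[R]_p) (a : R).

Definition dot x y : R := \sum_(i < p) x 0 i * y 0 i.

Lemma dotC x y : dot x y = dot y x.
Proof. by apply: eq_bigr => i _; rewrite mulrC. Qed.

Lemma dotDl x y z : dot (x + y) z = dot x z + dot y z.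
Proof. by rewrite -big_split; apply: eq_bigr => i _; rewrite mxE mulrDl. Qed.

Lemma dotZl a x y : dot (a *: x) y = a * dot x y.
Proof. by rewrite mulr_sumr; apply: eq_bigr => i _; rewrite mxE mulrA. Qed.

Lemma dotDr x y z : dot x (y + z) = dot x y + dot x z.
Proof. by rewrite ![dot x _]dotC dotDl. Qed.

Lemma dotZr a x y : dot x (a *: y) = a * dot x y.
Proof. by rewrite ![dot x _]dotC dotZl. Qed.

Lemma dotNl x y : dot (- x) y = - dot x y.
Proof. by rewrite -scaleN1r dotZl mulN1r. Qed.

Lemma dotNr x y : dot x (- y) = - dot x y.
Proof. by rewrite -scaleN1r dotZr mulN1r. Qed.

Lemma dot_suml (I : Type) (r : seq I) (F : I -> 'rV[R]_p) y :
  dot (\sum_(i <- r) F i) y = \sum_(i <- r) dot (F i) y.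
Proof.
elim/big_ind2: _ => [|x1 a x2 b <- <-|//].
  by rewrite /dot big1// => i _; rewrite mxE mul0r.
by rewrite dotDl.
Qed.

Definition dotE := (dotDl, dotDr, dotNl, dotNr, dotZl, dotZr).

Lemma dot_ge0 x : 0 <= dot x x.
Proof. by apply: sumr_ge0 => i _; rewrite -expr2 sqr_ge0. Qed.

Lemma dot_eq0 x : dot x x = 0 -> x = 0.
Proof.
move=> /eqP; rewrite psumr_eq0; last by move=> i _; rewrite -expr2 sqr_ge0.
move=> /allP x0; apply/rowP => i; rewrite mxE; apply/eqP.
by have /implyP := x0 i (mem_index_enum _); rewrite mulf_eq0 orbb => ->.
Qed.

Lemma sqr_enorm x : enorm x ^+ 2 = dot x x.
Proof.
rewrite sqr_sqrtr; last by apply: sumr_ge0 => i _; rewrite sqr_ge0.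
by apply: eq_bigr => i _; rewrite expr2.
Qed.

Lemma enorm_ge0 x : 0 <= enorm x.
Proof. exact: sqrtr_ge0. Qed.

Lemma enorm_eq0 x : enorm x = 0 -> x = 0.
Proof. by move=> x0; apply: dot_eq0; rewrite -sqr_enorm x0 expr0n. Qed.

Lemma le_enorm x a : 0 <= a -> dot x x <= a ^+ 2 -> enorm x <= a.
Proof.
by move=> a0 xa; rewrite -(@ler_pXn2r _ 2)// ?nnegrE ?enorm_ge0// sqr_enorm.
Qed.

(** Cauchy-Schwarz: the squared norm of [dot y y *: x - dot x y *: y] is nonnegative and equals
    [dot y y] times the gap. *)
Lemma sqr_dot_le x y : dot x y ^+ 2 <= dot x x * dot y y.
Proof.
have [/dot_eq0 ->|y0] := eqVneq (dot y y) 0.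
  by rewrite -[0 : 'rV__](scale0r 0) !dotE !mul0r expr0n mulr0.
have ypos : 0 < dot y y by rewrite lt_def y0 dot_ge0.
have := dot_ge0 (dot y y *: x - dot x y *: y).
rewrite !dotE (dotC y x); set a := dot x x; set b := dot x y; set c := dot y y.
move=> h; have {h}: 0 <= c * (a * c - b ^+ 2) by nra.
by rewrite pmulr_rge0// subr_ge0.
Qed.

Lemma dot_le_enorm x y : dot x y <= enorm x * enorm y.
Proof.
rewrite (le_trans (ler_norm _))// -(@ler_pXn2r _ 2)// ?nnegrE//; last first.
  by rewrite mulr_ge0 ?enorm_ge0.
by rewrite real_normK ?num_real// exprMn !sqr_enorm sqr_dot_le.
Qed.

Lemma enormD x y : enorm (x + y) <= enorm x + enorm y.
Proof.
apply: le_enorm; first by rewrite addr_ge0 ?enorm_ge0.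
have := dot_le_enorm x y; rewrite !dotE (dotC y x) sqrrD !sqr_enorm; lra.
Qed.

Lemma enormZ a x : enorm (a *: x) = `|a| * enorm x.
Proof.
rewrite /enorm -sqrtr_sqr -sqrtrM ?sqr_ge0// mulr_sumr; congr Num.sqrt.
by apply: eq_bigr => i _; rewrite mxE exprMn.
Qed.

Lemma enormN x : enorm (- x) = enorm x.
Proof. by rewrite -scaleN1r enormZ normrN1 mul1r. Qed.

Lemma enormB x y : enorm (x - y) = enorm (y - x).
Proof. by rewrite -enormN opprB. Qed.

Lemma enorm0 : enorm (0 : 'rV[R]_p) = 0.
Proof. by rewrite -(scale0r 0) enormZ normr0 mul0r. Qed.

Lemma enorm_sum (I : Type) (r : seq I) (F : I -> 'rV[R]_p) :
  enorm (\sum_(i <- r) F i) <= \sum_(i <- r) enorm (F i).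
Proof.
elim/big_ind2: _ => [|x a y b xa yb|//]; first by rewrite enorm0.
by rewrite (le_trans (enormD _ _))// lerD.
Qed.

Lemma enorm_trans x y z : enorm (x - z) <= enorm (x - y) + enorm (y - z).
Proof. by rewrite (le_trans _ (enormD _ _))// addrA subrK. Qed.

Lemma sqr_enormD x y :
  enorm (x + y) ^+ 2 <= 2 * enorm x ^+ 2 + 2 * enorm y ^+ 2.
Proof.
by have := dot_ge0 (x - y); rewrite !sqr_enorm !dotE (dotC y x); lra.
Qed.

(** The sup norm is attained at one coordinate, whose square is one term of the Euclidean sum.
    Euclidean bounds thereby yield boundedness in the ambient topology. *)
Lemma normr_le_enorm x : `|x| <= enorm x.
Proof.
have [->|/mx_norm_neq0 [[i j]]] := eqVneq `|x| 0; first exact: enorm_ge0.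
rewrite [X in X <= _]/Num.norm /= => ->; rewrite ord1 /=.
rewrite -[X in X <= _]sqrtr_sqr ler_wsqrtr// (bigD1 j)//=.
by rewrite lerDl; apply: sumr_ge0 => k _; rewrite sqr_ge0.
Qed.

Lemma continuous_sqr_enormB z : continuous (fun x => enorm (x - z) ^+ 2).
Proof.
have coordB i : continuous (fun x : 'rV[R]_p => (x - z) 0 i).
  have -> : (fun x : 'rV[R]_p => (x - z) 0 i) = (fun x => x 0 i - z 0 i).
    by apply/funext => x; rewrite !mxE.
  move=> x; apply: (@cvgB _ _ _ (nbhs x)); last exact: cvg_cst.
  exact: coord_continuous.
under eq_fun do rewrite sqr_enorm.
move=> x; apply: (@cvg_big _ _ _ _ _ add_continuous _ (nbhs x)) => i _.
by apply: (@cvgM _ _ (nbhs x)); exact: coordB.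
Qed.

End Euclidean.

(** * Minimizers, strong subgradients and proximal maps *)

Section Minimizers.
Context {R : realType} {p : nat}.
Implicit Types (g : 'rV[R]_p -> \bar R) (w x y z v : 'rV[R]_p).

(** The set is the preimage of the closed epigraph of [g] under the continuous map
    [x |-> (x, a - phi x)]. *)
Lemma closed_sublevel g (phi : 'rV[R]_p -> R) (a : R) :
  closed_fun g -> continuous phi ->
  closed [set x | (g x + (phi x)%:E <= a%:E)%E].
Proof.
move=> cg cphi.
have -> : [set x | (g x + (phi x)%:E <= a%:E)%E] =
  (fun x => (x, a - phi x)) @^-1` [set z : 'rV[R]_p * R | (g z.1 <= z.2%:E)%E].
  by apply/seteqP; split => x /=; rewrite EFinB leeBrDr.
apply: closed_comp => // x _.
apply: (@cvg_pair _ _ _ (nbhs x) (nbhs x) (nbhs (a - phi x))) => /=; first exact: cvg_id.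
by apply: (@cvgB _ _ _ (nbhs x)); [exact: cvg_cst|exact: cphi].
Qed.

(** Weierstrass for a lower semicontinuous function that may take the value [+oo]. The nonempty
    traces on [K] of its sublevel sets are nested and generate a filter; a cluster point in [K] lies
    in every one of these closed sublevel sets. *)
Lemma compact_min g (phi : 'rV[R]_p -> R) (K : set 'rV[R]_p) :
  (forall x, g x <> -oo%E) -> closed_fun g -> continuous phi -> compact K ->
  (K `&` edom g) !=set0 ->
  exists2 x, K x &
    forall y, K y -> (g x + (phi x)%:E <= g y + (phi y)%:E)%E.
Proof.
move=> gNy cg cphi cK [x0 [Kx0 gx0]].
have fin y : edom g y -> (g y + (phi y)%:E)%E \is a fin_num.
  by rewrite /edom/=; case: (g y) (gNy y).
pose lev (a : R) := [set x | (g x + (phi x)%:E <= a%:E)%E].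
pose D := [set a | exists2 y, K y & lev a y].
have D0 : D (fine (g x0 + (phi x0)%:E)%E).
  by exists x0 => //; rewrite /lev/= fineK// fin.
have FF : ProperFilter (filter_from D (fun a => K `&` lev a)).
  apply: filter_from_proper; last by move=> a [y Ky ay]; exists y.
  apply: filter_from_filter; first by exists (fine (g x0 + (phi x0)%:E)%E).
  move=> a b Da Db; exists (Num.min a b).
    by rewrite /Num.min; case: ifP.
  move=> x [Kx]; rewrite /lev/= EFin_min le_min => /andP[xa xb].
  by split; split.
have [x [Kx clx]] : K `&` cluster (filter_from D (fun a => K `&` lev a)) !=set0.
  by apply: cK; exists (fine (g x0 + (phi x0)%:E)%E) => // x [].
exists x => // y Ky.
have [gy|] := boolP (g y < +oo)%E; last first.
  by rewrite -leNgt leye_eq => /eqP ->; rewrite addye// leey.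
rewrite -(fineK (fin _ gy)); set a := fine _.
have Da : D a by exists y; rewrite // /lev/= fineK// fin.
apply: (closed_sublevel cg cphi) => B /(clx (K `&` lev a)) []; first by exists a.
by move=> z [[_ ?] ?]; exists z.
Qed.

Lemma compact_ball_enorm (x0 : 'rV[R]_p) (r : R) :
  compact [set x | enorm (x - x0) <= r].
Proof.
apply: bounded_closed_compact.
  exists (r + enorm x0); split; first by rewrite num_real.
  move=> b rb x /= xr; rewrite (le_trans (normr_le_enorm _))//.
  by rewrite -(subrK x0 x) (le_trans (enormD _ _))// ltW// (le_lt_trans _ rb)// lerD2r.
have [r0|r0] := leP 0 r; last first.
  rewrite (_ : [set x | _] = set0); first exact: closed0.
  by apply/seteqP; split => x //=; rewrite leNgt (lt_le_trans r0)// enorm_ge0.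
have -> : [set x | enorm (x - x0) <= r] =
  (fun x => enorm (x - x0) ^+ 2) @^-1` [set t | t <= r ^+ 2].
  by apply/seteqP; split => x /=; rewrite ler_pXn2r// nnegrE enorm_ge0.
by apply: closed_comp => [x _|]; [exact: continuous_sqr_enormB|exact: closed_le].
Qed.

Lemma strongly_convex_le mu g x y (a b t : R) :
  (forall x, g x <> -oo%E) -> strongly_convex mu g -> 0 <= t <= 1 ->
  g x = a%:E -> g y = b%:E ->
  (g (t *: x + (1 - t) *: y)%R
    <= (t * a + (1 - t) * b - mu / 2 * t * (1 - t) * enorm (x - y) ^+ 2)%:E)%E.
Proof.
move=> gNy cg t01 gx gy; have := cg x y t t01; rewrite gx gy.
rewrite -!EFinB -!EFinM -EFinD leeBlDr// -EFinD => /le_trans; apply.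
rewrite lee_fin !sqr_enorm !dotE (dotC y x) le_eqVlt; apply/orP; left.
by apply/eqP; field.
Qed.

Lemma convex_strongly_convex0 g : convex_fun g -> strongly_convex 0 g.
Proof. by move=> cg x y t t01; rewrite !mul0r !sube0; exact: cg. Qed.

(** Stands for the passage to the limit [t -> 0] in first-order conditions; for negative [a] an
    explicit small [t] gives the contradiction. *)
Lemma ge0_affine (a b : R) : (forall t, 0 < t <= 1 -> 0 <= a + t * b) -> 0 <= a.
Proof.
move=> h; rewrite leNgt; apply/negP => a0.
have b0 : 0 <= `|b| by [].
have bb := ler_norm b.
have c0 : 0 < - a + `|b| + 1 by lra.
have tc : - a / (- a + `|b| + 1) * (- a + `|b| + 1) = - a.
  by rewrite divfK// gt_eqF.
have t0 : 0 < - a / (- a + `|b| + 1) by rewrite divr_gt0//; lra.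
have := h (- a / (- a + `|b| + 1)); rewrite t0 ler_pdivrMr// mul1r.
move: t0 tc; set t := _ / _ => t0 tc; have : t * b <= t * `|b| by rewrite ler_pM2l.
nra.
Qed.

(** The subgradient inequality with the quadratic gain of [mu]-strong convexity; [mu = 0] is the
    ordinary subdifferential. [fine] is applied only on the domain, where a proper [g] is finite. *)
Definition strong_subgrad (mu : R) g (a : 'rV[R]_p) x :=
  edom g x /\ forall v, edom g v ->
    fine (g x) + dot a (v - x) + mu / 2 * enorm (v - x) ^+ 2 <= fine (g v).

Lemma edom_fineK g x : (forall x, g x <> -oo%E) -> edom g x ->
  g x = (fine (g x))%:E.
Proof. by move=> /(_ x); rewrite /edom/=; case: (g x). Qed.

(** Fermat's rule for [g + phi], where [phi] has slope [- a] at [x] up to second order: compare [x]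
    with a point at fraction [t] towards [v], divide by [t] and let [t] vanish. *)
Lemma minimizer_subgrad (mu : R) g (phi k : 'rV[R]_p -> R) a x :
  proper_fun g -> strongly_convex mu g ->
  (forall v, (g x + (phi x)%:E <= g v + (phi v)%:E)%E) ->
  (forall v t, 0 <= t <= 1 ->
    phi (t *: v + (1 - t) *: x) <= phi x - t * dot a (v - x) + t ^+ 2 * k v) ->
  strong_subgrad mu g a x.
Proof.
move=> [gNy [v0 gv0]] cg xmin dphi.
have gx : edom g x.
  rewrite /edom/= ltey; apply/eqP => gx; have := xmin v0.
  by rewrite gx (edom_fineK gNy gv0) addye// leye_eq.
split=> // v gv.
have gxE := edom_fineK gNy gx; have gvE := edom_fineK gNy gv.
rewrite -subr_ge0.
(* [b] collects the second-order terms: the remainder of [phi] and the loss from the factor [1 - t]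
   in strong convexity. *)
apply: (ge0_affine (b := k v + mu / 2 * enorm (v - x) ^+ 2)) => t /andP[t0 t1].
have t01 : 0 <= t <= 1 by rewrite ltW.
have := le_trans (xmin (t *: v + (1 - t) *: x))
  (leeD2r _ (strongly_convex_le gNy cg t01 gvE gxE)).
rewrite {1}gxE -!EFinD lee_fin => h; have := dphi v t t01.
rewrite -(pmulr_rge0 _ t0); move: h; nra.
Qed.

(** Strong monotonicity: each subgradient inequality is tested at the other point, the two are
    added, and Cauchy-Schwarz is applied. Using subgradients in place of [prox] lets it serve fixed
    points such as [u0star] as well. *)
Lemma subgrad_contract (mu eta : R) g w w' x x' : 0 <= mu -> 0 < eta ->
  strong_subgrad mu g (eta^-1 *: (w - x)) x -> strong_subgrad mu g (eta^-1 *: (w' - x')) x' ->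
  (1 + eta * mu) * enorm (x - x') <= enorm (w - w').
Proof.
move=> mu0 eta0 [gx hx] [gx' hx'].
have [e0|e0] := eqVneq (enorm (x - x')) 0; first by rewrite e0 mulr0 enorm_ge0.
have epos : 0 < enorm (x - x') by rewrite lt_def e0 enorm_ge0.
rewrite -(ler_pM2r epos) (le_trans _ (dot_le_enorm _ _))// -mulrA -expr2.
have {hx hx'} := lerD (hx _ gx') (hx' _ gx).
rewrite (enormB x' x) !dotZl !sqr_enorm => h.
have {h} : eta * (eta^-1 * dot (w - x) (x' - x) + eta^-1 * dot (w' - x') (x - x')
  + mu * dot (x - x') (x - x')) <= 0 by rewrite pmulr_rle0//; lra.
rewrite !mulrDr !mulrA divff ?gt_eqF// !mul1r.
by rewrite !dotE; rewrite (dotC x' x); lra.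
Qed.

Lemma prox_exists g (eta : R) w :
  proper_fun g -> closed_fun g -> convex_fun g -> 0 < eta ->
  exists x, forall v, (g x + ((2 * eta)^-1 * enorm (x - w) ^+ 2)%:E
       <= g v + ((2 * eta)^-1 * enorm (v - w) ^+ 2)%:E)%E.
Proof.
move=> [gNy [x0 gx0]] clg cvg eta0.
have gx0E := edom_fineK gNy gx0.
(* By convexity, a lower bound [m] of [g] on the unit ball around [x0] forces
   [g] to decrease at most linearly outside it, so the quadratic wins. *)
have [xm _ xmin] : exists2 x, enorm (x - x0) <= 1 &
    forall y, enorm (y - x0) <= 1 -> (g x + 0%:E <= g y + 0%:E)%E.
  apply: (@compact_min g (fun=> 0) [set x | enorm (x - x0) <= 1]) => //.
  - exact: cst_continuous.
  - exact: compact_ball_enorm.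
  - by exists x0; split => //=; rewrite subrr enorm0.
have gxm : edom g xm.
  have := xmin x0; rewrite subrr enorm0 => /(_ ler01).
  by rewrite !adde0 => /le_lt_trans; apply.
have gxmE := edom_fineK gNy gxm.
set a := fine (g x0) in gx0E; set m := fine (g xm) in gxmE.
have ma : m <= a.
  have := xmin x0; rewrite subrr enorm0 => /(_ ler01).
  by rewrite !adde0 gx0E gxmE lee_fin.
set s := enorm (x0 - w).
have s0 : 0 <= s by exact: enorm_ge0.
(* For [d > r] one has [(d - s) ^ 2 - s ^ 2 = d * (d - 2 * s) >= 2 * eta * d * (a - m)], so the
   quadratic outweighs a decrease of [g] by [d * (a - m)]. *)
pose r := 1 + 2 * s + 2 * eta * (a - m).
have r1 : 1 <= r by rewrite /r -addrA lerDl; nra.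
have cphi : continuous (fun x => (2 * eta)^-1 * enorm (x - w) ^+ 2).
  by move=> x; apply: (@cvgM _ _ (nbhs x));
     [exact: cvg_cst|exact: continuous_sqr_enormB].
have [|x xr xP] := compact_min gNy clg cphi (@compact_ball_enorm x0 r).
  by exists x0; split => //=; rewrite subrr enorm0 (le_trans ler01).
exists x => v; have [vr|rv] := leP (enorm (v - x0)) r; first exact: xP.
have x0r : enorm (x0 - x0) <= r by rewrite subrr enorm0 (le_trans ler01).
apply: (le_trans (xP _ x0r)).
have [gv|] := boolP (g v < +oo)%E; last first.
  by rewrite -leNgt leye_eq => /eqP ->; rewrite addye// leey.
have gvE := edom_fineK gNy gv; set b := fine (g v) in gvE.
set d := enorm (v - x0) in rv.
have d0 : 0 < d by rewrite (lt_trans _ rv)// (lt_le_trans ltr01).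
have t01 : 0 <= d^-1 <= 1.
  by rewrite invr_ge0 ltW//= invf_le1// ltW// (le_lt_trans r1).
have mb : m <= d^-1 * b + (1 - d^-1) * a.
  have := strongly_convex_le gNy (convex_strongly_convex0 cvg) t01 gvE gx0E.
  rewrite mul0r !mul0r subr0 => /(le_trans _); rewrite -lee_fin -gxmE; apply.
  have := xmin (d^-1 *: v + (1 - d^-1) *: x0); rewrite !adde0; apply.
  have -> : d^-1 *: v + (1 - d^-1) *: x0 - x0 = d^-1 *: (v - x0).
    by rewrite scalerBl scale1r scalerBr addrCA (addrC x0) addrK.
  rewrite enormZ.
  by rewrite gtr0_norm ?invr_gt0// mulVf ?lexx ?gt_eqF.
have {}mb : d * m <= b + (d - 1) * a.
  have := ler_wpM2l (ltW d0) mb; rewrite mulrDr !mulrA mulrBr mulr1.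
  by rewrite divff ?gt_eqF// mul1r.
rewrite gvE gx0E -!EFinD lee_fin -/s.
have dvw : d - s <= enorm (v - w).
  by rewrite lerBlDr /s (enormB x0 w); exact: enorm_trans.
have sd : s <= d - s by rewrite /r in rv; nra.
have q2 : (d - s) ^+ 2 <= enorm (v - w) ^+ 2.
  by rewrite ler_pXn2r// nnegrE ?enorm_ge0//; lra.
have e2 : 0 < (2 * eta)^-1 by rewrite invr_gt0 mulr_gt0.
have : (2 * eta)^-1 * (d - s) ^+ 2 <= (2 * eta)^-1 * enorm (v - w) ^+ 2.
  by rewrite ler_pM2l.
have : (2 * eta)^-1 * s ^+ 2 + d * (a - m) <= (2 * eta)^-1 * (d - s) ^+ 2.
  rewrite -(ler_pM2l (_ : 0 < 2 * eta)) ?mulr_gt0// mulrDr !mulrA.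
  by rewrite divff ?gt_eqF ?mulr_gt0// !mul1r; rewrite /r in rv; nra.
lra.
Qed.

Lemma prox_subgrad (mu eta : R) g w : proper_fun g -> closed_fun g ->
  convex_fun g -> strongly_convex mu g -> 0 < eta ->
  strong_subgrad mu g (eta^-1 *: (w - prox eta g w)) (prox eta g w).
Proof.
move=> pg clg cg scg eta0.
(* Existence ensures that the choice in [prox] is a true minimizer and not a default value. *)
have xmin := getPex (prox_exists w pg clg cg eta0).
rewrite -/(prox eta g w) in xmin; set x := prox eta g w in xmin *.
apply: (minimizer_subgrad (phi := fun v => (2 * eta)^-1 * enorm (v - w) ^+ 2)
  (k := fun v => (2 * eta)^-1 * enorm (v - x) ^+ 2)) => // v t t01.
rewrite dotZl !sqr_enorm !dotE (dotC x v) (dotC w v) (dotC w x).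
rewrite le_eqVlt; apply/orP; left; apply/eqP; field.
by rewrite gt_eqF.
Qed.

End Minimizers.

(** * Quadratic models and gradient steps for smooth functions *)

Section Gradients.
Context {R : realType} {p : nat}.
Implicit Types (F : 'rV[R]_p -> R) (x y v : 'rV[R]_p) (L mu eta : R).

Lemma derive_grad F x v : differentiable F x -> 'D_v F x = dot (grad F x) v.
Proof.
move=> dF; rewrite deriveE// {1}(row_sum_delta v) linear_sum.
apply: eq_bigr => i _.
by rewrite linearZ/= mxE deriveE// mulrC.
Qed.

Lemma is_derive_line F x v (t : R) : differentiable F (x + t *: v) ->
  is_derive t 1 (fun s : R => F (x + s *: v)) (dot (grad F (x + t *: v)) v).
Proof.
move=> dF; rewrite -derive_grad//.
have E : (fun h : R => h^-1 *: (((fun s : R => F (x + s *: v)) \o shift t) (h *: 1)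
            - F (x + t *: v))) =
    (fun h : R => h^-1 *: ((F \o shift (x + t *: v)) (h *: v) - F (x + t *: v))).
  apply/funext => h /=; congr (_ *: (F _ - _)).
  by rewrite [h *: 1]mulr1 scalerDl addrCA.
split; last by rewrite /derive E.
by rewrite /derivable E; exact: diff_derivable.
Qed.

(** Descent lemma, by the mean value theorem for [psi], which is [F] along the segment minus its
    linear term and [k * s ^ 2]. The Lipschitz bound makes the derivative of [psi] nonpositive on
    [(0, 1)]. *)
Lemma quad_upper F L :
  (forall x, differentiable F x) -> 0 <= L ->
  (forall x y, enorm (grad F x - grad F y) <= L * enorm (x - y)) ->
  forall x y, F y <= F x + dot (grad F x) (y - x) + L / 2 * enorm (y - x) ^+ 2.
Proof.
move=> dF L0 lip x y; set v := y - x; set c := dot (grad F x) v.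
set k := L / 2 * enorm v ^+ 2.
pose phi := fun s : R => F (x + s *: v).
pose psi : R -> R := phi - c *: id - k *: (id ^+ 2).
have dpsi (t : R) :
    is_derive t 1 psi (dot (grad F (x + t *: v)) v - c - k * (2 * t)).
  have dphi := @is_derive_line F x v t (dF (x + t *: v)); rewrite -/phi in dphi.
  apply: is_derive_eq.
  by rewrite expr1 /GRing.scale/= !mulr1.
have [|xi] := @MVT R psi (fun t => dot (grad F (x + t *: v)) v - c - k * (2 * t))
    0 1 ltr01 (fun t _ => dpsi t).
  apply: continuous_subspaceT => t.
  by apply/differentiable_continuous/derivable1_diffP; have [] := dpsi t.
rewrite in_itv/= => /andP[xi0 xi1]; rewrite subr0 mulr1.
have -> : psi 1 = F y - c - k.
  by rewrite /psi !fctE /phi scale1r /v [x + _]addrC subrK expr1n /GRing.scale/= !mulr1.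
have -> : psi 0 = F x.
  by rewrite /psi !fctE /phi scale0r addr0 expr0n /GRing.scale/= !mulr0 !subr0.
have : dot (grad F (x + xi *: v)) v - c <= k * (2 * xi).
  rewrite /c -dotNl -dotDl (le_trans (dot_le_enorm _ _))//.
  have e : x + xi *: v - x = xi *: v by rewrite [x + _]addrC addrK.
  have := lip (x + xi *: v) x; rewrite e enormZ gtr0_norm// => /ler_wpM2r.
  move=> /(_ _ (enorm_ge0 v)) /le_trans; apply; rewrite /k.
  by rewrite le_eqVlt; apply/orP; left; apply/eqP; field.
lra.
Qed.

(** [quad_upper] with the two points swapped, after moving the gradient from [y] back to [x]. The
    resulting constant [3 / 2 * L] is rounded up to [2 * L]. *)
Lemma quad_lower F L :
  (forall x, differentiable F x) -> 0 <= L ->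
  (forall x y, enorm (grad F x - grad F y) <= L * enorm (x - y)) ->
  forall x y,
    F x + dot (grad F x) (y - x) - 2 * L * enorm (y - x) ^+ 2 <= F y.
Proof.
move=> dF L0 lip x y; have := quad_upper dF L0 lip y x.
have := dot_le_enorm (grad F x - grad F y) (y - x).
have := ler_wpM2r (enorm_ge0 (y - x)) (lip x y).
rewrite !(enormB x y).
have : 0 <= L * enorm (y - x) ^+ 2 by rewrite mulr_ge0// sqr_ge0.
rewrite -(opprB y x) dotNr dotDl dotNl; lra.
Qed.

(** Near [x] on the segment, [quad_lower] bounds [F] from below and strong convexity from above;
    dividing by [t] and letting it vanish leaves the first-order inequality. *)
Lemma strongly_convex_grad mu F L :
  (forall x, differentiable F x) -> 0 <= L ->
  (forall x y, enorm (grad F x - grad F y) <= L * enorm (x - y)) ->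
  strongly_convex mu (fun x => (F x)%:E) ->
  forall x y, F x + dot (grad F x) (y - x) + mu / 2 * enorm (y - x) ^+ 2 <= F y.
Proof.
move=> dF L0 lip cF x y; rewrite -subr_ge0.
apply: (ge0_affine (b := (2 * L + mu / 2) * enorm (y - x) ^+ 2)) => t /andP[t0 t1].
have t01 : 0 <= t <= 1 by rewrite ltW.
have := @strongly_convex_le _ _ mu _ y x (F y) (F x) t _ cF t01 erefl erefl.
rewrite lee_fin => /(_ (fun _ => ltac:(discriminate))).
have := quad_lower dF L0 lip x (t *: y + (1 - t) *: x).
have -> : t *: y + (1 - t) *: x - x = t *: (y - x).
  by rewrite scalerBl scale1r scalerBr addrCA (addrC x) addrK.
rewrite dotZr enormZ gtr0_norm// exprMn => h1 h2.
rewrite -(pmulr_rge0 _ t0); nra.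
Qed.

(** Splitting [G y - G x = mu *: d + k] separates the exact factor [1 - eta * mu] on [d] from a
    residual [k] that is cocoercive and therefore does not increase the norm. *)
Lemma gd_contract F (G : 'rV[R]_p -> 'rV[R]_p) L mu eta :
  0 <= mu -> 0 < eta -> eta * (L + mu) <= 2 ->
  (forall x y, F x + dot (G x) (y - x) + mu / 2 * enorm (y - x) ^+ 2 <= F y) ->
  (forall x y, F y <= F x + dot (G x) (y - x) + L / 2 * enorm (y - x) ^+ 2) ->
  forall x y, enorm (x - eta *: G x - (y - eta *: G y))
    <= Num.max 0 (1 - eta * mu) * enorm (x - y).
Proof.
move=> mu0 eta0 etaL low up x y.
have [d0|d0] := eqVneq (enorm (x - y)) 0.
  move/enorm_eq0/eqP : (d0); rewrite subr_eq0 => /eqP ->.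
  by rewrite !subrr enorm0 mulr0.
have dpos : 0 < enorm (x - y) by rewrite lt_def d0 enorm_ge0.
(* Two distinct points force [mu <= L], hence [eta * mu <= 1]; in dimension 0 this may fail, which
   is why the factor is a maximum with 0. *)
have muL : mu <= L.
  have := le_trans (low x y) (up x y).
  by rewrite lerD2l ler_pM2r ?exprn_gt0// 1?enormB// ler_pM2r.
have em1 : 0 <= 1 - eta * mu by nra.
rewrite (max_r em1); apply: le_enorm; first by rewrite mulr_ge0 ?enorm_ge0.
rewrite exprMn sqr_enorm.
have [d dE] : exists d, d = y - x by exists (y - x).
have [k kE] : exists k, k = G y - G x - mu *: d by eexists.
(* Comparing the lower model of F at one point with the upper model at the
   other, at a gradient step of length s, yields cocoercivity. *)
have coco s : (2 * s - (L - mu) * s ^+ 2) * dot k k <= dot k d.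
  have h1 := le_trans (low x (y - s *: k)) (up y (y - s *: k)).
  have h2 := le_trans (low y (x + s *: k)) (up x (x + s *: k)).
  have ky : dot (G y) k = dot k k + dot (G x) k + mu * dot k d.
    rewrite (dotC k d) -dotZl -!dotDl; congr dot; rewrite kE.
    by apply/rowP => i; rewrite !mxE; ring.
  have kd : dot k d = dot (G y) d - dot (G x) d - mu * dot d d.
    by rewrite kE !dotE.
  have e1 : y - s *: k - x = d - s *: k by rewrite dE addrAC.
  have e2 : y - s *: k - y = - s *: k by rewrite addrAC subrr add0r scaleNr.
  have e3 : x + s *: k - y = - d + s *: k by rewrite dE opprB addrAC.
  have e4 : x + s *: k - x = s *: k by rewrite [x + _]addrC addrK.
  move: h1 h2; rewrite e1 e2 e3 e4 !sqr_enorm !dotE ky (dotC d k) => h1 h2.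
  move: kd; lra.
have kk0 : 0 <= dot k k by exact: dot_ge0.
have keta : eta * dot k k <= 2 * (1 - eta * mu) * dot k d.
  set m := 2 * (1 - eta * mu).
  have lm : eta * (L - mu) <= m by rewrite /m; lra.
  (* If [eta * mu = 1], then [L = mu] and [coco] is linear in [s], so a large [s] forces
     [dot k k = 0]. Otherwise [s = eta / m] is the suitable step. *)
  have [m0|m0] := leP m 0.
    have -> : m = 0 by rewrite /m in m0 *; lra.
    rewrite mul0r pmulr_rle0// leNgt; apply/negP => kpos.
    have kd0 : 0 <= `|dot k d| by [].
    have kd1 := ler_norm (dot k d).
    have := coco ((`|dot k d| + 1) / dot k k); set s := _ / _.
    have s0 : 0 < s by rewrite divr_gt0// ltr_pwDr.
    have sk : s * dot k k = `|dot k d| + 1 by rewrite divfK// gt_eqF.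
    have : (L - mu) * s ^+ 2 * dot k k <= 0.
      by rewrite mulr_le0_ge0// mulr_le0_ge0 ?sqr_ge0//; nra.
    nra.
  have := coco (eta / m); set s := eta / m.
  have s0 : 0 < s by rewrite divr_gt0.
  have sm : s * m = eta by rewrite divfK// gt_eqF.
  have ls : (L - mu) * s <= 1.
    by rewrite /s mulrA ler_pdivrMr// mul1r mulrC.
  have h : s * dot k k <= (2 * s - (L - mu) * s ^+ 2) * dot k k.
    by rewrite ler_wpM2r// expr2 mulrA; nra.
  move=> /(le_trans h); rewrite -(ler_pM2l m0) mulrA (mulrC m s) sm.
  by rewrite mulrC.
have -> : x - eta *: G x - (y - eta *: G y) = eta *: k - (1 - eta * mu) *: d.
  by rewrite kE dE; apply/rowP => i; rewrite !mxE; ring.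
rewrite -(opprB y x) -dE !dotE (dotC d k).
have := ler_wpM2l (ltW eta0) keta.
lra.
Qed.

End Gradients.

(** * Scalar inequalities, the output rule, and derivatives of averages *)

Lemma sqr_avg_le (R : realType) (n : nat) (a : 'I_n -> R) : (0 < n)%N ->
  (n%:R^-1 * \sum_i a i) ^+ 2 <= n%:R^-1 * \sum_i a i ^+ 2.
Proof.
move=> n0; set m := n%:R^-1 * \sum_i a i.
have nn : n%:R != 0 :> R by rewrite pnatr_eq0 -lt0n.
have mE : \sum_i a i = n%:R * m by rewrite mulVKf.
have : 0 <= n%:R^-1 * \sum_i (a i - m) ^+ 2.
  by rewrite mulr_ge0 ?invr_ge0// sumr_ge0// => i _; rewrite sqr_ge0.
under eq_bigr do rewrite sqrrB.
rewrite big_split/= sumrB sumrMnl -mulr_suml mE sumr_const card_ord -mulr_natl.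
set S2 := \sum_i a i ^+ 2 => h.
rewrite -subr_ge0; apply: (le_trans h).
by rewrite le_eqVlt; apply/orP; left; apply/eqP; field.
Qed.

(** After multiplication by [1 - r], the gap is [r * ((1 - r) * a - b) ^ 2]. It keeps the
    contraction factor [r] unsquared when the lag recursion is squared. *)
Lemma sqr_convex_le (R : realType) (r a b : R) : 0 <= r < 1 ->
  (r * a + b) ^+ 2 <= r * a ^+ 2 + (1 - r)^-1 * b ^+ 2.
Proof.
move=> /andP[r0 r1]; have r1' : 0 < 1 - r by rewrite subr_gt0.
rewrite -(ler_pM2l r1') mulrDr mulrA [(1 - r) * (_^-1 * _)]mulrA divff ?gt_eqF//.
by have := mulr_ge0 r0 (sqr_ge0 ((1 - r) * a - b)); nra.
Qed.

(** [G] is the squared gradient mapping, [Y] the squared move of [w], [Z] and [Z'] the squared lags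
    before and after the epoch, [X] the one after the ascent, [e] the squared gradient error. Since
    [lam * (1 - r) = 2 * N], the decrease of the weighted lag cancels [16 * eta ^ 2 * N * Z]; the
    last two hypotheses absorb the error terms in [G] and [Y]. *)
Lemma lyapunov_step (R : realType)
  (eta G P B N X Z Z' Y e psi psi' r lam k : R) :
  0 < eta -> 0 <= G -> 0 <= Y -> 0 <= N -> 0 <= lam ->
  8 * eta * (psi' - psi) + Y + eta ^+ 2 * G / 2 <= 16 * eta ^+ 2 * e ->
  e <= eta ^+ 2 * P * G + eta ^+ 2 * B + N * X -> X <= Z ->
  Z' <= r * Z + k * Y -> lam * (1 - r) = 2 * N ->
  64 * eta ^+ 2 * P <= 1 -> 8 * eta ^+ 2 * lam * k <= 1 ->
  eta * G <= 64 * eta ^+ 3 * B +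
    32 * (psi + eta * lam * Z - (psi' + eta * lam * Z')).
Proof.
move=> eta0 G0 Y0 N0 lam0 hpsi he XZ hZ' hlam hP hk.
have eta2 : 0 <= eta ^+ 2 by exact: sqr_ge0.
have h1 := ler_wpM2l eta2 he.
have h2 := ler_wpM2l eta2 (ler_wpM2l N0 XZ).
have h3 := ler_wpM2r (mulr_ge0 eta2 G0) hP.
have h4 := ler_wpM2l (mulr_ge0 eta2 lam0) hZ'.
have h5 := ler_wpM2r Y0 hk.
have h6 : eta ^+ 2 * lam * Z = 2 * eta ^+ 2 * N * Z + eta ^+ 2 * lam * r * Z.
  have -> : 2 * eta ^+ 2 * N * Z = eta ^+ 2 * Z * (2 * N) by ring.
  by rewrite -hlam; ring.
rewrite -(ler_pM2l eta0) exprS.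
have -> : eta * (eta * G) = eta ^+ 2 * G by ring.
have -> : eta * (64 * (eta * eta ^+ 2) * B
    + 32 * (psi + eta * lam * Z - (psi' + eta * lam * Z')))
  = 64 * (eta ^+ 2 * (eta ^+ 2 * B)) - 32 * (eta * (psi' - psi))
    + 32 * (eta ^+ 2 * lam * Z) - 32 * (eta ^+ 2 * lam * Z') by ring.
rewrite !mulrDr in h1 h4.
lra.
Qed.

(** For a minimizing index the integrand is pointwise at most the average; for a uniform index the
    integral splits over the events [tstar = t], each of mass [1 / (T + 1)]. *)
Lemma output_rule_expectation (R : realType) (d : measure_display)
    (Omega : measurableType d) (P : probability Omega R) (T : nat)
    (v : nat -> R) (tstar : Omega -> nat) (b : R) :
  (forall t, 0 <= v t) -> output_rule P T v tstar ->
  T.+1%:R^-1 * \sum_(0 <= t < T.+1) v t ^+ 2 <= b ->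
  ('E_P[(fun om => v (tstar om) ^+ 2)%R] <= b%:E)%E.
Proof.
move=> v0 [mt rule] avg; rewrite unlock.
have TT : 0 < T.+1%:R :> R by rewrite ltr0n.
have pre (Y : set nat) : measurable (tstar @^-1` Y).
  by rewrite -[X in measurable X]setTI; exact: (mt measurableT).
pose f om : \bar R := (v (tstar om) ^+ 2)%:E.
have mf (D : set Omega) : measurable_fun D f.
  apply: (@measurable_funS _ _ _ _ setT) => // _ Y _; rewrite setTI.
  exact: (pre (fun k => Y (v k ^+ 2)%:E)).
have f0 om : (0 <= f om)%E by rewrite lee_fin sqr_ge0.
rewrite -/f; case: rule => [argmin|unif].
  apply: (@le_trans _ _ (\int[P]_(x in setT) cst b%:E x)%E); last first.
    rewrite integral_cst// [X in (_ * X <= _)%E](_ : _ = 1%E) ?mule1//.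
    exact: probability_setT.
  apply: (ge0_le_integral P measurableT (fun om _ => f0 om)) => //.
  move=> om _; rewrite /f /cst lee_fin. apply: (le_trans _ avg).
  rewrite ler_pdivlMl//; have [tT tmin] := argmin om.
  have -> : T.+1%:R * v (tstar om) ^+ 2 = \sum_(0 <= t < T.+1) v (tstar om) ^+ 2.
    by rewrite sumr_const_nat subn0 mulr_natl.
  rewrite !big_mkord; apply: ler_sum => t _.
  by rewrite ler_pXn2r ?nnegrE//; apply: tmin; rewrite -ltnS.
pose A t := [set om | tstar om = t].
have mA t : measurable (A t) by exact: (pre [set t]).
have tA : trivIset setT A.
  by apply/trivIsetP => i j _ _ /eqP ij; apply/seteqP; split => om // [] ei ej; apply: ij;
     rewrite -[LHS]ei -[RHS]ej.
pose U := \big[setU/set0]_(t <- iota 0 T.+1) A t.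
have mU : measurable U by apply: bigsetU_measurable.
(* The uniform rule prescribes masses only for [t <= T]; they add up to 1, so larger values of
   [tstar] are negligible. *)
have PU : P U = 1%E.
  rewrite /U -/(index_iota 0 T.+1) big_mkord measure_bigsetU//.
  rewrite (eq_bigr (fun=> (T.+1%:R^-1)%:E)) => [|t _]; last first.
    by apply: unif; rewrite -ltnS.
  by rewrite sumEFin sumr_const card_ord -[_ *+ _]mulr_natl divff ?gt_eqF.
have PCU : P (~` U) = 0%E by rewrite probability_setC// PU subee.
have -> : (\int[P]_x f x = \int[P]_(x in U) f x)%E.
  rewrite (ge0_negligible_integral (measurableC mU) measurableT (mf _)
    (fun x _ => f0 x) PCU).
  by rewrite setTD setCK.
rewrite (ge0_integral_bigsetU P mA (iota_uniq _ _) (sub_trivIset _ tA) (mf _)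
  (fun x _ => f0 x))//.
apply: (@le_trans _ _ (\sum_(t <- iota 0 T.+1) (v t ^+ 2 * T.+1%:R^-1)%:E)%E).
  rewrite !big_seq; apply: lee_sum => t; rewrite mem_iota add0n => /andP[_ tT].
  have fA x : x \in A t -> f x = cst (v t ^+ 2)%:E x.
    by rewrite inE /A/= /f => ->.
  rewrite (eq_integral _ _ fA) integral_cst// le_eqVlt; apply/orP; left.
  by apply/eqP; rewrite [RHS]EFinM; congr (_ * _)%E; exact: unif.
rewrite sumEFin lee_fin; apply: le_trans avg.
by rewrite -mulr_suml mulrC.
Qed.

(** The noise term and the initial gap each take at most half of the budget [c * eps ^ 3 * T]: the
    first by smallness of [c], the second by the number of epochs. *)
Lemma avg_le_sqr (R : realFieldType) (c eps B D0 C T S : R) :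
  0 < c -> 0 < eps -> 0 < T -> 128 * c ^+ 2 * B <= 1 -> 64 * D0 <= c * C ->
  C / eps ^+ 3 <= T ->
  c * eps * S <= T * (64 * (c * eps) ^+ 3 * B) + 32 * D0 ->
  T^-1 * S <= eps ^+ 2.
Proof.
move=> c0 eps0 T0 hB hD hT hS.
have e3 : 0 < eps ^+ 3 by rewrite exprn_gt0.
rewrite ler_pdivrMl// -(ler_pM2l (mulr_gt0 c0 eps0)); apply: (le_trans hS).
have h1 : T * (64 * (c * eps) ^+ 3 * B) * 2 <= c * eps ^+ 3 * T.
  have -> : T * (64 * (c * eps) ^+ 3 * B) * 2
      = 128 * c ^+ 2 * B * (c * eps ^+ 3 * T) by ring.
  by rewrite ler_piMl// ltW// !mulr_gt0.
have h2 : 64 * D0 <= c * (T * eps ^+ 3).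
  by apply: (le_trans hD); rewrite ler_pM2l// -ler_pdivrMr.
have -> : c * eps * (T * eps ^+ 2) = c * eps ^+ 3 * T by ring.
lra.
Qed.

Lemma small_step (R : realFieldType) (a1 a2 a3 a4 a5 : R) :
  0 <= a1 -> 0 <= a2 -> 0 <= a3 -> 0 <= a4 -> 0 <= a5 ->
  exists2 c, 0 < c <= 1 &
    [/\ c * a1 <= 1, c * a2 <= 1, c * a3 <= 1, c * a4 <= 1 & c * a5 <= 1].
Proof.
move=> h1 h2 h3 h4 h5; have z1 : 1 <= 1 + a1 + a2 + a3 + a4 + a5 by lra.
have z0 := lt_le_trans ltr01 z1.
exists (1 + a1 + a2 + a3 + a4 + a5)^-1; first by rewrite invr_gt0 z0 invf_le1.
by split; rewrite ler_pdivrMl// mulr1; lra.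
Qed.

(** A two-sided quadratic remainder makes the difference quotient differ from [l] by [O(h)]. It
    yields directional derivatives of [Phi0] without prior differentiability. *)
Lemma derive_quad (R : realType) (p : nat) (F : 'rV[R]_p -> R) x v (l C : R) :
  (forall h, `|F (h *: v + x) - F x - h * l| <= C * h ^+ 2) -> 'D_v F x = l.
Proof.
move=> bF; apply: cvg_lim => //; apply/cvgrPdist_le => e e0.
have C1 : 0 < `|C| + 1 by rewrite ltr_pwDr.
near=> h.
have h0 : h != 0 by near: h; exact: nbhs_dnbhs_neq.
have he : `|h| <= e / (`|C| + 1).
  near: h; apply: dnbhs0_le; exact: divr_gt0.
have -> : l - h^-1 *: ((F \o shift x) (h *: v) - F x) =
    - (h^-1 * (F (h *: v + x) - F x - h * l)).
  by rewrite [in RHS]mulrBr mulKf// opprB.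
rewrite normrN normrM normfV mulrC ler_pdivrMr ?normr_gt0//.
apply: (le_trans (bF h)); rewrite -[h ^+ 2]ger0_norm ?sqr_ge0// normrX expr2 mulrA.
rewrite ler_wpM2r//; move: he; rewrite ler_pdivlMr// => he.
have := ler_norm C; have := normr_ge0 h; have := normr_ge0 C; nra.
Unshelve. all: by end_near. Qed.

Lemma grad_opp (R : realType) (p : nat) (F : 'rV[R]_p -> R) x :
  differentiable F x -> grad (fun y => - F y) x = - grad F x.
Proof.
move=> dF; apply/rowP => i; rewrite !mxE.
rewrite (_ : (fun y => - F y) = - F)// deriveN//; exact: diff_derivable.
Qed.

Lemma grad_avg (R : realType) (p n : nat) (F : 'I_n -> 'rV[R]_p -> R) (c : R) x :
  (forall i, differentiable (F i) x) ->
  grad (fun y => c * \sum_(i < n) F i y) x = c *: \sum_(i < n) grad (F i) x.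
Proof.
move=> dF; apply/rowP => j; rewrite !mxE summxE.
have -> : (fun y => c * \sum_(i < n) F i y) = c *: (\sum_(i < n) F i).
  by apply/funext => y; rewrite fctE fct_sumE.
have dFj i : derivable (F i) x (delta_mx 0 j) by exact: diff_derivable.
rewrite deriveZ; last exact: derivable_sum.
rewrite derive_sum//; congr (_ * _).
by apply: eq_bigr => i _; rewrite mxE.
Qed.

Lemma enorm_avg_le (R : realType) (p n : nat) (a b : 'I_n -> 'rV[R]_p) (c : R) :
  (0 < n)%N -> (forall i, enorm (a i - b i) <= c) ->
  enorm (n%:R^-1 *: (\sum_i a i) - n%:R^-1 *: (\sum_i b i)) <= c.
Proof.
move=> n0 ab; rewrite -scalerBr -sumrB enormZ ger0_norm ?invr_ge0//.
rewrite mulrC ler_pdivrMr ?ltr0n//; apply: (le_trans (enorm_sum _ _)).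
apply: (le_trans (ler_sum _ (fun i _ => ab i))).
by rewrite sumr_const card_ord mulr_natr.
Qed.

(** * Lipschitz partial gradients and concavity of the averaged coupling *)

Section Problem.
Context {R : realType} {n p q : nat} (Q : minimax R n p q).
Context (Lw Lu muH muh Thw sgw Thu sgu : R).
Hypothesis sa : standing_assumptions Q Lw Lu muH muh Thw sgw Thu sgu.
Hypotheses (Lw0 : 0 <= Lw) (Lu0 : 0 <= Lu) (muH0 : 0 <= muH) (muh0 : 0 <= muh).
Implicit Types (w : 'rV[R]_p) (u : 'rV[R]_q).

Local Notation H := (mH Q).
Local Notation Hi := (mHi Q).

Lemma mHi_diffw i w u : differentiable (fun w' => Hi i (w', u)) w.
Proof.
apply: (differentiable_comp (f := fun w' => (w', u)) (g := Hi i)).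
  by apply: differentiable_pair; [exact: ex_diff|exact: differentiable_cst].
exact: (sa_H_diff sa).
Qed.

Lemma mHi_diffu i w u : differentiable (fun u' => Hi i (w, u')) u.
Proof.
apply: (differentiable_comp (f := fun u' => (w, u')) (g := Hi i)).
  by apply: differentiable_pair; [exact: differentiable_cst|exact: ex_diff].
exact: (sa_H_diff sa).
Qed.

Lemma mH_diffw w u : differentiable (fun w' => H (w', u)) w.
Proof.
rewrite /mH; have -> : (fun w' => n%:R^-1 * \sum_(i < n) Hi i (w', u)) =
    n%:R^-1 *: (\sum_(i < n) (fun w' => Hi i (w', u))).
  by apply/funext => y; rewrite fctE fct_sumE.
by apply: differentiableZ; apply: differentiable_sum => i; exact: mHi_diffw.
Qed.

Lemma mH_diffu w u : differentiable (fun u' => H (w, u')) u.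
Proof.
rewrite /mH; have -> : (fun u' => n%:R^-1 * \sum_(i < n) Hi i (w, u')) =
    n%:R^-1 *: (\sum_(i < n) (fun u' => Hi i (w, u'))).
  by apply/funext => y; rewrite fctE fct_sumE.
by apply: differentiableZ; apply: differentiable_sum => i; exact: mHi_diffu.
Qed.

Lemma gradw_mH w u : gradw H w u = n%:R^-1 *: \sum_(i < n) gradw (Hi i) w u.
Proof. by apply: (grad_avg (F := fun i w' => Hi i (w', u))) => i; exact: mHi_diffw. Qed.

Lemma gradu_mH w u : gradu H w u = n%:R^-1 *: \sum_(i < n) gradu (Hi i) w u.
Proof. by apply: (grad_avg (F := fun i u' => Hi i (w, u'))) => i; exact: mHi_diffu. Qed.

Lemma gradw_lipw i w w' u :
  enorm (gradw (Hi i) w u - gradw (Hi i) w' u) <= Lw * enorm (w - w').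
Proof.
apply: le_enorm; first by rewrite mulr_ge0 ?enorm_ge0.
have := sa_H_smooth sa i w w' u u; rewrite subrr enorm0 expr0n mulr0 addr0.
rewrite exprMn -sqr_enorm; apply: le_trans; by rewrite lerDl sqr_ge0.
Qed.

Lemma gradw_lipu i w u u' :
  enorm (gradw (Hi i) w u - gradw (Hi i) w u') <= Lu * enorm (u - u').
Proof.
apply: le_enorm; first by rewrite mulr_ge0 ?enorm_ge0.
have := sa_H_smooth sa i w w u u'; rewrite subrr enorm0 expr0n mulr0 add0r.
rewrite exprMn -sqr_enorm; apply: le_trans; by rewrite lerDl sqr_ge0.
Qed.

Lemma gradu_lipw i w w' u :
  enorm (gradu (Hi i) w u - gradu (Hi i) w' u) <= Lw * enorm (w - w').
Proof.
apply: le_enorm; first by rewrite mulr_ge0 ?enorm_ge0.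
have := sa_H_smooth sa i w w' u u; rewrite subrr enorm0 expr0n mulr0 addr0.
rewrite exprMn -sqr_enorm; apply: le_trans; by rewrite lerDr sqr_ge0.
Qed.

Lemma gradu_lipu i w u u' :
  enorm (gradu (Hi i) w u - gradu (Hi i) w u') <= Lu * enorm (u - u').
Proof.
apply: le_enorm; first by rewrite mulr_ge0 ?enorm_ge0.
have := sa_H_smooth sa i w w u u'; rewrite subrr enorm0 expr0n mulr0 add0r.
rewrite exprMn -sqr_enorm; apply: le_trans; by rewrite lerDr sqr_ge0.
Qed.

Lemma gradw_mH_lipw w w' u :
  enorm (gradw H w u - gradw H w' u) <= Lw * enorm (w - w').
Proof.
by rewrite !gradw_mH; apply: enorm_avg_le => [|i]; [exact: sa_n sa|exact: gradw_lipw].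
Qed.

Lemma gradw_mH_lipu w u u' :
  enorm (gradw H w u - gradw H w u') <= Lu * enorm (u - u').
Proof.
by rewrite !gradw_mH; apply: enorm_avg_le => [|i]; [exact: sa_n sa|exact: gradw_lipu].
Qed.

Lemma gradu_mH_lipw w w' u :
  enorm (gradu H w u - gradu H w' u) <= Lw * enorm (w - w').
Proof.
by rewrite !gradu_mH; apply: enorm_avg_le => [|i]; [exact: sa_n sa|exact: gradu_lipw].
Qed.

Lemma gradu_mH_lipu w u u' :
  enorm (gradu H w u - gradu H w u') <= Lu * enorm (u - u').
Proof.
by rewrite !gradu_mH; apply: enorm_avg_le => [|i]; [exact: sa_n sa|exact: gradu_lipu].
Qed.

(** Strong concavity is assumed for each component, so its first-order form is derived componentwise
    and then averaged. *)
Lemma mH_concave w u u' :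
  H (w, u') <= H (w, u) + dot (gradu H w u) (u' - u) - muH / 2 * enorm (u' - u) ^+ 2.
Proof.
have nn : 0 < n%:R :> R by rewrite ltr0n (sa_n sa).
have hi i : Hi i (w, u') <= Hi i (w, u) + dot (gradu (Hi i) w u) (u' - u)
    - muH / 2 * enorm (u' - u) ^+ 2.
  have gE x : grad (fun u' => - Hi i (w, u')) x = - gradu (Hi i) w x.
    by rewrite grad_opp//; exact: mHi_diffu.
  have dN x : differentiable (fun u' => - Hi i (w, u')) x.
    by apply: differentiableN; exact: mHi_diffu.
  have lip x y : enorm (grad (fun u' => - Hi i (w, u')) x
      - grad (fun u' => - Hi i (w, u')) y) <= Lu * enorm (x - y).
    by rewrite !gE -opprD enormN gradu_lipu.
  have := strongly_convex_grad dN Lu0 lip (sa_H_concave sa i w) u u'.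
  by rewrite gE dotNl; lra.
have /(_ (index_enum 'I_n)) := ler_sum _ (fun i (_ : xpredT i) => hi i).
rewrite sumrB big_split/= -dot_suml sumr_const card_ord -[_ *+ n]mulr_natr.
move=> h; have nV : 0 <= n%:R^-1 :> R by rewrite invr_ge0 ltW.
have := ler_wpM2l nV h; rewrite gradu_mH dotZl mulrBr mulrDr [_ * n%:R]mulrC mulKf//.
by rewrite gt_eqF.
Qed.

Lemma mH_lower w u u' :
  H (w, u) + dot (gradu H w u) (u' - u) - Lu / 2 * enorm (u' - u) ^+ 2 <= H (w, u').
Proof.
have gE x : grad (fun u' => - H (w, u')) x = - gradu H w x.
  by rewrite grad_opp//; exact: mH_diffu.
have dN x : differentiable (fun u' => - H (w, u')) x.
  by apply: differentiableN; exact: mH_diffu.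
have lip x y : enorm (grad (fun u' => - H (w, u')) x - grad (fun u' => - H (w, u')) y)
    <= Lu * enorm (x - y).
  by rewrite !gE -opprD enormN gradu_mH_lipu.
by have := quad_upper dN Lu0 lip u u'; rewrite gE dotNl; lra.
Qed.

(** * The inner maximizer and its optimality condition *)

Lemma bounded_edom_h : exists2 K : set 'rV[R]_q, compact K & edom (mh Q) `<=` K.
Proof.
have [M [_ hM]] := sa_h_bounded sa.
exists [set u | `|u| <= M + 1]; last by move=> u; apply: hM; rewrite ltrDl.
apply: bounded_closed_compact.
  exists (M + 1); split; first by rewrite num_real.
  by move=> b Mb u /= /le_trans; apply; exact: ltW.
rewrite (_ : [set u | _] = Num.norm @^-1` [set t | t <= M + 1])//.
by apply: closed_comp => [u _|]; [exact: norm_continuous|exact: closed_le].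
Qed.

(** A maximizer exists because [mh Q] is closed and its domain lies in a compact set; hence the
    choice in [u0star] is a genuine maximizer. *)
Lemma u0star_max w u : (((H (w, u))%:E - mh Q u)%E <=
  ((H (w, u0star Q w))%:E - mh Q (u0star Q w)))%E.
Proof.
have [[hNy [u0 hu0]] hcl _] := sa_h sa.
have [K cK hK] := bounded_edom_h.
have cH : continuous (fun u' => - H (w, u')).
  by move=> x; apply: differentiable_continuous; apply: differentiableN;
     exact: mH_diffu.
have [|x Kx xmin] := compact_min hNy hcl cH cK.
  by exists u0; split => //; exact: hK.
suff ex : exists x, forall u', (((H (w, u'))%:E - mh Q u')%E <=
    ((H (w, x))%:E - mh Q x))%E by exact: getPex ex u.
exists x => u'; have [hu'|] := boolP (mh Q u' < +oo)%E; last first.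
  by rewrite -leNgt leye_eq => /eqP ->; rewrite addeNy leNye.
have := xmin u' (hK _ hu'); rewrite (edom_fineK hNy hu').
case: (mh Q x) (hNy x) => //= r _; rewrite !lee_fin; lra.
Qed.

Lemma u0star_subgrad w : strong_subgrad muh (mh Q) (gradu H w (u0star Q w)) (u0star Q w).
Proof.
have [hp _ _] := sa_h sa; have [hNy _] := hp.
set us := u0star Q w.
apply: (minimizer_subgrad (phi := fun u => - H (w, u))
  (k := fun u => Lu / 2 * enorm (u - us) ^+ 2)) => //.
- exact: (sa_h_strong sa).
- move=> v; have := u0star_max w v; rewrite -/us.
  case: (mh Q v) (hNy v) => [b _||]//; case: (mh Q us) (hNy us) => [a _||]//.
  + by rewrite !lee_fin; lra.
  + by rewrite leey.
- move=> v t t01; have := mH_lower w us (t *: v + (1 - t) *: us).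
  have -> : t *: v + (1 - t) *: us - us = t *: (v - us).
    by rewrite scalerBl scale1r scalerBr addrCA (addrC us) addrK.
  by rewrite dotZr enormZ exprMn real_normK ?num_real//; lra.
Qed.

(** * Contraction of the ascent step and Lipschitz dependence of the maximizer *)

Context (etah : R).
Hypotheses (etah_gt0 : 0 < etah) (etah_le : etah <= 2 / (Lu + muH)).
Hypothesis mu_gt0 : 0 < muH + muh.

(** The numerator comes from the gradient step on the concave coupling, the denominator from the
    proximal step of the strongly convex [mh Q]. *)
Definition contraction_rate : R := Num.max 0 (1 - etah * muH) / (1 + etah * muh).
Local Notation rho := contraction_rate.

Lemma contraction_rate_ge0 : 0 <= rho.
Proof. by rewrite divr_ge0 ?le_max ?lexx// addr_ge0// mulr_ge0// ltW. Qed.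

Lemma contraction_rate_lt1 : rho < 1.
Proof.
have h0 : 0 <= etah * muh by rewrite mulr_ge0// ltW.
rewrite ltr_pdivrMr ?ltr_pwDl// mul1r gt_max ltr_pwDl//=.
have := mulr_gt0 etah_gt0 mu_gt0; lra.
Qed.

Lemma etah_sum_le2 : etah * (Lu + muH) <= 2.
Proof.
have s0 : 0 <= Lu + muH by rewrite addr_ge0.
(* The bound [etah_le] can be multiplied out only for a nonzero denominator; otherwise the product
   is 0. *)
have [s1|s1] := eqVneq (Lu + muH) 0; first by rewrite s1 mulr0.
by rewrite -ler_pdivlMr// lt_def s1.
Qed.

Definition ascent w u : 'rV[R]_q := prox etah (mh Q) (u + etah *: gradu H w u).

Lemma ascent_gd_contract w u u' :
  enorm (u + etah *: gradu H w u - (u' + etah *: gradu H w u'))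
    <= Num.max 0 (1 - etah * muH) * enorm (u - u').
Proof.
have gN x : etah *: gradu H w x = - (etah *: - gradu H w x).
  by rewrite scalerN opprK.
rewrite (gN u) (gN u').
apply: (@gd_contract _ _ (fun u => - H (w, u)) (fun u => - gradu H w u)
  Lu muH etah muH0 etah_gt0 etah_sum_le2) => x y.
- by have := mH_concave w x y; rewrite dotNl; lra.
- by have := mH_lower w x y; rewrite dotNl; lra.
Qed.

(** Optimality of [u0star] rescaled to the optimality condition of a proximal point: it is a fixed
    point of the ascent map, in the form required by [subgrad_contract]. *)
Lemma u0star_prox_subgrad w : strong_subgrad muh (mh Q)
  (etah^-1 *: (u0star Q w + etah *: gradu H w (u0star Q w) - u0star Q w))
  (u0star Q w).
Proof.
rewrite [u0star _ _ + _]addrC addrK scalerA mulVf ?gt_eqF// scale1r.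
exact: u0star_subgrad.
Qed.

Lemma ascent_contract w u :
  enorm (ascent w u - u0star Q w) <= rho * enorm (u - u0star Q w).
Proof.
have [hp hcl hc] := sa_h sa.
have d0 : 0 < 1 + etah * muh by rewrite ltr_pwDl// mulr_ge0// ltW.
rewrite /rho mulrAC ler_pdivlMr// mulrC.
apply: le_trans (ascent_gd_contract w u (u0star Q w)).
apply: (subgrad_contract muh0 etah_gt0 _ (u0star_prox_subgrad w)).
by apply: prox_subgrad => //; exact: (sa_h_strong sa).
Qed.

Definition u0star_lip_const : R := etah * Lw / (1 - rho).
Local Notation kap := u0star_lip_const.

Lemma u0star_lip_const_ge0 : 0 <= kap.
Proof.
apply: divr_ge0; first by rewrite mulr_ge0// ltW.
by rewrite subr_ge0 ltW// contraction_rate_lt1.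
Qed.

(** Perturbation of a fixed point: the ascent maps at [w] and [w'] contract with rate [rho] and
    differ by at most [etah * Lw * enorm (w - w')], which is then divided by [1 - rho]. *)
Lemma u0star_lip w w' :
  enorm (u0star Q w - u0star Q w') <= kap * enorm (w - w').
Proof.
have key (m r x e1 e2 e3 t : R) : m * x <= e1 -> e1 <= e2 + e3 ->
    e2 <= r * m * x -> e3 <= t -> t <= m * t -> m * (x - r * x) <= m * t.
  by move=> *; lra.
have d0 : 1 <= 1 + etah * muh by rewrite lerDl mulr_ge0// ltW.
set a := u0star Q w; set b := u0star Q w'.
have h1 := subgrad_contract muh0 etah_gt0 (u0star_prox_subgrad w) (u0star_prox_subgrad w').
rewrite -/a -/b in h1.
have h2 := enorm_trans (a + etah *: gradu H w a) (b + etah *: gradu H w b)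
  (b + etah *: gradu H w' b).
have h3 := ascent_gd_contract w a b.
have h4 : enorm (b + etah *: gradu H w b - (b + etah *: gradu H w' b))
    <= etah * (Lw * enorm (w - w')).
  rewrite opprD addrACA subrr add0r -scalerBr enormZ gtr0_norm// ler_pM2l//.
  exact: gradu_mH_lipw.
rewrite /kap mulrAC ler_pdivlMr ?subr_gt0 ?contraction_rate_lt1// mulrBr mulr1.
rewrite [enorm _ * rho]mulrC.
have rhoE : rho * (1 + etah * muh) = Num.max 0 (1 - etah * muH).
  by rewrite divfK// gt_eqF// (lt_le_trans ltr01).
rewrite -rhoE in h3.
have e0 : 0 <= etah * (Lw * enorm (w - w')).
  by rewrite mulr_ge0 ?(ltW etah_gt0)// mulr_ge0 ?enorm_ge0.
have := key _ _ _ _ _ _ _ h1 h2 h3 h4 (ler_peMl e0 d0).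
rewrite ler_pM2l ?(lt_le_trans ltr01)// => /le_trans; apply.
by rewrite mulrA.
Qed.

Lemma fine_h_u0star w : mh Q (u0star Q w) = (fine (mh Q (u0star Q w)))%:E.
Proof.
have [[hNy _] _ _] := sa_h sa.
by apply: edom_fineK => //; have [] := u0star_subgrad w.
Qed.

Lemma Phi0E w : Phi0 Q w = (H (w, u0star Q w) - fine (mh Q (u0star Q w)))%:E.
Proof.
rewrite EFinB -fine_h_u0star; apply/eqP; rewrite eq_le; apply/andP; split.
  by apply: ge_ereal_sup => _ [u _ <-]; exact: u0star_max.
by apply: ereal_sup_ubound; exists (u0star Q w).
Qed.

(** * Danskin's formula and the quadratic model of [Phi0] *)

Local Notation Phi := (fun w => fine (Phi0 Q w)).

Lemma Phi_ge w w' :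
  H (w, u0star Q w') - fine (mh Q (u0star Q w')) <= Phi w.
Proof.
have h := u0star_max w (u0star Q w').
by rewrite Phi0E; rewrite (fine_h_u0star w) (fine_h_u0star w') lee_fin in h.
Qed.

Definition Phi_smooth_const : R := 2 * Lw + Lu * kap.
Local Notation LP := Phi_smooth_const.

Lemma Phi_smooth_const_ge0 : 0 <= LP.
Proof.
by apply: addr_ge0; apply: mulr_ge0 => //; exact: u0star_lip_const_ge0.
Qed.

(** Freezing the maximizer of [w] bounds [Phi w'] from below. Freezing that of [w'] bounds it from
    above with the gradient taken at the wrong maximizer; correcting this costs [Lu * kap]. *)
Lemma Phi_quad w w' :
  `|Phi w' - Phi w - dot (gradw H w (u0star Q w)) (w' - w)|
    <= LP * enorm (w' - w) ^+ 2.
Proof.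
rewrite /LP; have hk := u0star_lip w' w; have k0 := u0star_lip_const_ge0.
move: kap hk k0 => k hk k0.
set d := w' - w; set a := u0star Q w; set b := u0star Q w'.
have dH u x : differentiable (fun w => H (w, u)) x by exact: mH_diffw.
have lip u x y : enorm (grad (fun w => H (w, u)) x - grad (fun w => H (w, u)) y)
    <= Lw * enorm (x - y) by exact: gradw_mH_lipw.
have low : Phi w + dot (gradw H w a) d - 2 * Lw * enorm d ^+ 2 <= Phi w'.
  apply: (le_trans _ (Phi_ge w' w)); rewrite Phi0E /= -/a.
  by have := quad_lower (dH a) Lw0 (lip a) w w'; rewrite -/d /gradw; lra.
have up : Phi w' <= Phi w + dot (gradw H w a) d + (2 * Lw + Lu * k) * enorm d ^+ 2.
  have h1 := Phi_ge w w'; rewrite -/b in h1.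
  have h2 := quad_upper (dH b) Lw0 (lip b) w w'; rewrite -/d -/(gradw H w b) in h2.
  have h3 := dot_le_enorm (gradw H w b - gradw H w a) d.
  have h4 := ler_wpM2r (enorm_ge0 d) (gradw_mH_lipu w b a).
  have h5 := ler_wpM2r (enorm_ge0 d) (ler_wpM2l Lu0 hk).
  rewrite -/a -/b -/d in h5; rewrite dotDl dotNl in h3.
  have h6 : 0 <= Lw * enorm d ^+ 2 by rewrite mulr_ge0// sqr_ge0.
  rewrite [in leLHS]Phi0E /= -/b; lra.
have : 0 <= Lu * k * enorm d ^+ 2.
  by apply: mulr_ge0 (sqr_ge0 _); exact: mulr_ge0.
by rewrite ler_norml; move: low up; lra.
Qed.

Lemma gradPhi0E w : gradPhi0 Q w = gradw H w (u0star Q w).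
Proof.
apply/rowP => i; rewrite mxE.
have -> : gradw H w (u0star Q w) 0 i = dot (gradw H w (u0star Q w)) (delta_mx 0 i).
  rewrite /dot (bigD1 i)//= big1 => [|j ji].
    by rewrite [delta_mx _ _ _ _]mxE !eqxx mulr1 addr0.
  by rewrite [X in _ * X]mxE (negbTE ji) andbF mulr0.
apply: (@derive_quad _ _ _ _ _ _ (LP * enorm (delta_mx 0 i : 'rV[R]_p) ^+ 2)) => h.
have := Phi_quad w (h *: delta_mx 0 i + w).
rewrite addrK dotZr enormZ exprMn real_normK ?num_real// => /le_trans; apply.
by rewrite le_eqVlt; apply/orP; left; apply/eqP; ring.
Qed.

Lemma Phi_upper w w' :
  Phi w' <= Phi w + dot (gradPhi0 Q w) (w' - w) + LP * enorm (w' - w) ^+ 2.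
Proof. by have := Phi_quad w w'; rewrite ler_norml gradPhi0E; lra. Qed.

(** * The shuffled pass against a full gradient step *)

Lemma foldl_descent_count (eta : R) u w k (l : seq 'I_n) :
  (foldl (descent_step Q eta u) (w, k) l).2 = (k + size l)%N.
Proof. by elim: l w k => [|i l IH] w k /=; rewrite ?addn0// IH addSnnS. Qed.

Definition avg_gradw w u : R := n%:R^-1 * \sum_(i < n) enorm (gradw (Hi i) w u).

(** Induction over prefixes of the pass: each step adds [eta / n] times the change of one component
    gradient between [w] and the current point. Only the sum of the gradient norms over [l] enters,
    so the order of the indices is immaterial. *)
Lemma foldl_descent_dist (eta : R) u w k (l : seq 'I_n) : 0 < eta ->
  2 * (eta * Lw) <= 1 -> (size l <= n)%N ->
  \sum_(i <- l) enorm (gradw (Hi i) w u) <= n%:R * avg_gradw w u ->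
  enorm ((foldl (descent_step Q eta u) (w, k) l).1
      - (w - (eta / n%:R) *: \sum_(i <- l) gradw (Hi i) w u))
    <= (size l)%:R / n%:R * (2 * eta ^+ 2 * Lw * avg_gradw w u).
Proof.
move=> eta0 etaL; set A := avg_gradw w u.
have nn : 0 < n%:R :> R by rewrite ltr0n (sa_n sa).
have A0 : 0 <= A.
  apply: mulr_ge0; first by rewrite invr_ge0 ltW.
  by apply: sumr_ge0 => i _; exact: enorm_ge0.
have en0 : 0 < eta / n%:R by rewrite divr_gt0.
elim/last_ind: l => [_ _|l i IH].
  by rewrite big_nil scaler0 subr0 subrr enorm0 !mul0r.
rewrite size_rcons -cats1 foldl_cat => ln sumle.
have sum0 : \sum_(j <- l) enorm (gradw (Hi j) w u) <= n%:R * A.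
  by apply: (le_trans _ sumle); rewrite big_cat/= big_seq1 lerDl enorm_ge0.
have {IH} := IH (ltnW ln) sum0.
rewrite [in X in X -> _]/= [\sum_(j <- l ++ _) _]big_cat big_seq1 /=.
set x := (foldl _ _ l).1; set s := \sum_(j <- l) gradw _ _ _.
set B := 2 * eta ^+ 2 * Lw * A => IH.
have B0 : 0 <= B by do 3!apply: mulr_ge0 => //; exact: sqr_ge0.
have lB : (size l)%:R / n%:R * B <= B.
  by rewrite ler_piMl// ler_pdivrMr// mul1r ler_nat ltnW.
have ss : enorm ((eta / n%:R) *: s) <= eta * A.
  rewrite enormZ gtr0_norm// -mulrA ler_pM2l// mulrC ler_pdivrMr// mulrC.
  exact: le_trans (enorm_sum _ _) sum0.
have xw : enorm (x - w) <= 2 * eta * A.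
  have -> : x - w = x - (w - (eta / n%:R) *: s) - (eta / n%:R) *: s.
    by rewrite opprB addrA addrAC addrK.
  apply: (le_trans (enormD _ _)); rewrite enormN.
  have : B <= eta * A.
    have -> : B = 2 * (eta * Lw) * (eta * A) by rewrite /B; ring.
    by rewrite ler_piMl// mulr_ge0// ltW.
  lra.
have -> : x - (eta / n%:R) *: gradw (Hi i) x u
      - (w - (eta / n%:R) *: (s + gradw (Hi i) w u))
    = x - (w - (eta / n%:R) *: s)
      - (eta / n%:R) *: (gradw (Hi i) x u - gradw (Hi i) w u).
  by apply/rowP => j; rewrite !mxE; ring.
apply: (le_trans (enormD _ _)); rewrite enormN enormZ gtr0_norm//.
have -> : (size l).+1%:R / n%:R * B = (size l)%:R / n%:R * B + n%:R^-1 * B.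
  by rewrite -addn1 natrD !mulrDl mul1r.
apply: lerD => //.
have -> : n%:R^-1 * B = eta / n%:R * (Lw * (2 * eta * A)) by rewrite /B; ring.
by rewrite ler_pM2l// (le_trans (gradw_lipw i x w u))// ler_wpM2l.
Qed.

Lemma sqr_avg_gradw_le w u : avg_gradw w u ^+ 2 <=
  2 * (Thw + 1) * enorm (gradw H w u) ^+ 2 + 2 * sgw ^+ 2.
Proof.
have nn : 0 < n%:R :> R by rewrite ltr0n (sa_n sa).
apply: (le_trans (sqr_avg_le _ (sa_n sa))).
have hi i : enorm (gradw (Hi i) w u) ^+ 2 <=
    2 * enorm (gradw (Hi i) w u - gradw H w u) ^+ 2 + 2 * enorm (gradw H w u) ^+ 2.
  by rewrite -{1}(subrK (gradw H w u) (gradw (Hi i) w u)) sqr_enormD.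
have /(_ (index_enum 'I_n)) := ler_sum _ (fun i (_ : xpredT i) => hi i).
rewrite big_split/= -mulr_sumr sumr_const card_ord -[_ *+ n]mulr_natl => h.
have nV : 0 <= n%:R^-1 :> R by rewrite invr_ge0 ltW.
have := ler_wpM2l nV h; rewrite mulrDr mulKf ?gt_eqF//.
have := sa_var_w sa w u; lra.
Qed.

(** * One proximal descent step with an inexact gradient *)

Context (Lam0 Lam1 eta : R).
Hypotheses (Thw0 : 0 <= Thw) (eta_gt0 : 0 < eta) (eta_le1 : eta <= 1).
Hypothesis eta_Lw : 2 * (eta * Lw) <= 1.
Hypothesis eta_LP : 2 * (eta * LP) <= 1.
Hypothesis gradPhi0_bound : forall w,
  enorm (gradPhi0 Q w) ^+ 2 <= Lam0 * enorm (gradmap Q eta w) ^+ 2 + Lam1.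

Local Notation psi := (fun w => fine (mf Q w) + Phi w).
Local Notation G w := (enorm (gradmap Q eta w) ^+ 2).

(** The subgradient inequality at [w'] is tested at [w] and added to the quadratic model of [Phi].
    The gradient mapping refers to the exact proximal point [wh], which nonexpansiveness places
    within [eta * e] of [w']. *)
Lemma prox_descent w W e : edom (mf Q) w -> 0 <= e ->
  enorm (W - (w - eta *: gradPhi0 Q w)) <= eta * e ->
  let w' := prox eta (mf Q) W in
  [/\ edom (mf Q) w' & 8 * eta * (psi w' - psi w) + enorm (w' - w) ^+ 2
      + eta ^+ 2 * G w / 2 <= 16 * eta ^+ 2 * e ^+ 2].
Proof.
move=> fw e0 We w'; have [fp fcl fc] := sa_f sa.
have pv W' := prox_subgrad W' fp fcl fc (convex_strongly_convex0 fc) eta_gt0.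
have [fw' hw'] := pv W; rewrite -/w' in fw' hw'; split => //.
have {hw'} := hw' _ fw; rewrite mul0r mul0r addr0 => hw'.
set v := W - (w - eta *: gradPhi0 Q w) in We.
set wh := prox eta (mf Q) (w - eta *: gradPhi0 Q w).
have w'wh : enorm (w' - wh) <= eta * e.
  have := subgrad_contract (lexx 0) eta_gt0 (pv W) (pv (w - eta *: gradPhi0 Q w)).
  by rewrite mulr0 addr0 mul1r -/v => /le_trans; apply.
have GE : eta ^+ 2 * G w = enorm (wh - w) ^+ 2.
  rewrite /gradmap enormZ -/wh exprMn mulrA real_normK ?num_real// exprVn.
  by rewrite divff ?mul1r ?expf_neq0 ?gt_eqF// enormB.
have G_le : eta ^+ 2 * G w <= 2 * enorm (w' - w) ^+ 2 + 2 * (eta * e) ^+ 2.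
  rewrite GE; have -> : wh - w = (w' - w) - (w' - wh).
    by rewrite opprB [RHS]addrC addrA subrK.
  apply: (le_trans (sqr_enormD _ _)); rewrite lerD2l enormN ler_pM2l//.
  by rewrite ler_pXn2r// nnegrE ?enorm_ge0// mulr_ge0// ltW.
have [d dE] : exists d, d = w' - w by eexists.
have hPhi := Phi_upper w w'; rewrite -dE in hPhi G_le *.
have vd := dot_le_enorm v d.
have {hw'} hw' : eta * fine (mf Q w') + enorm d ^+ 2 + eta * dot (gradPhi0 Q w) d
    - dot v d <= eta * fine (mf Q w).
  rewrite -(ler_pM2l eta_gt0) mulrDr in hw'; apply: le_trans hw'.
  rewrite -!addrA lerD2l dotZl mulrA divff ?gt_eqF// mul1r.
  have -> : W - w' = v - eta *: gradPhi0 Q w - d.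
    by rewrite /v dE; apply/rowP => i; rewrite !mxE; ring.
  have -> : w - w' = - d by rewrite dE opprB.
  by rewrite sqr_enorm !dotE; lra.
(* Young's inequality: with the half lost to the smoothness term, a quarter of [enorm d ^ 2] remains
   and pays for the squared move and the gradient mapping. *)
have vd2 : dot v d <= (eta * e) ^+ 2 + enorm d ^+ 2 / 4.
  apply: (le_trans vd); have := sqr_ge0 (eta * e - enorm d / 2).
  have := ler_wpM2r (enorm_ge0 d) We; nra.
have LPd : 2 * (eta * LP) * enorm d ^+ 2 <= enorm d ^+ 2.
  by rewrite ler_piMl ?sqr_ge0.
have := ler_wpM2l (ltW eta_gt0) hPhi; rewrite !mulrDr => hP.
have e2 : 0 <= (eta * e) ^+ 2 by exact: sqr_ge0.
have -> : 16 * eta ^+ 2 * e ^+ 2 = 16 * (eta * e) ^+ 2 by ring.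
move: hP hw' vd2 LPd G_le e2; move: (fine _) (fine _) (fine _) (fine _) => a b c f.
move: (dot _ _) (dot _ _) (enorm d ^+ 2) (G w) ((eta * e) ^+ 2) => x y z g s.
lra.
Qed.

Definition gradmap_coef : R := 32 * Lw ^+ 2 * (Thw + 1) * Lam0.
Definition noise_coef : R :=
  32 * Lw ^+ 2 * (Thw + 1) * Lam1 + 16 * Lw ^+ 2 * sgw ^+ 2.
Definition lag_coef : R := 32 * Lw ^+ 2 * (Thw + 1) * Lu ^+ 2 + 2 * Lu ^+ 2.
(** The solution of [lam * (1 - rho) = 2 * lag_coef], as demanded by [lyapunov_step]. *)
Definition lyapunov_weight : R := 2 * lag_coef / (1 - rho).
Definition lag_growth : R := (1 - rho)^-1 * kap ^+ 2.

Lemma lag_coef_ge0 : 0 <= lag_coef.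
Proof.
have T1 : 0 <= Thw + 1 by rewrite addr_ge0.
by rewrite addr_ge0 ?mulr_ge0 ?sqr_ge0.
Qed.

Lemma lyapunov_weight_ge0 : 0 <= lyapunov_weight.
Proof.
apply: divr_ge0; first by apply: mulr_ge0 => //; exact: lag_coef_ge0.
by rewrite subr_ge0 ltW// contraction_rate_lt1.
Qed.

Lemma epoch_error w u k (s : 'S_n) : exists2 e, 0 <= e &
  let W := (foldl (descent_step Q eta u) (w, k) [seq s i | i <- enum 'I_n]).1 in
  enorm (W - (w - eta *: gradPhi0 Q w)) <= eta * e /\
  e ^+ 2 <= eta ^+ 2 * gradmap_coef * G w + eta ^+ 2 * noise_coef
    + lag_coef * enorm (u - u0star Q w) ^+ 2.
Proof.
have nn : 0 < n%:R :> R by rewrite ltr0n (sa_n sa).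
set X := enorm (u - u0star Q w); set A := avg_gradw w u.
have X0 : 0 <= X by exact: enorm_ge0.
have A0 : 0 <= A.
  apply: mulr_ge0; first by rewrite invr_ge0 ltW.
  by apply: sumr_ge0 => i _; exact: enorm_ge0.
(* The first summand is the drift within the shuffled pass, the second the effect of using [u] in
   place of the maximizer. *)
exists (2 * eta * Lw * A + Lu * X).
  apply: addr_ge0; last exact: mulr_ge0.
  by do 3!apply: mulr_ge0 => //; exact: ltW.
have reidx (T : nmodType) (F : 'I_n -> T) :
    \sum_(i <- [seq s i | i <- enum 'I_n]) F i = \sum_(i < n) F i.
  by rewrite big_map big_enum/= [RHS](reindex_inj (@perm_inj _ s)).
have sz : size [seq s i | i <- enum 'I_n] = n by rewrite size_map size_enum_ord.
have lipX := gradw_mH_lipu w u (u0star Q w); rewrite -/X -gradPhi0E in lipX.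
move=> W; split.
  have h1 : enorm (W - (w - eta *: gradw H w u)) <= 2 * eta ^+ 2 * Lw * A.
    have := @foldl_descent_dist eta u w k _ eta_gt0 eta_Lw.
    move=> /(_ [seq s i | i <- enum 'I_n]); rewrite sz !reidx.
    rewrite gradw_mH scalerA divff ?gt_eqF// mul1r; apply => //.
    by rewrite /avg_gradw mulVKf// gt_eqF.
  apply: (le_trans (enorm_trans _ (w - eta *: gradw H w u) _)).
  have -> : eta * (2 * eta * Lw * A + Lu * X) = 2 * eta ^+ 2 * Lw * A + eta * (Lu * X).
    by ring.
  apply: lerD => //.
  have -> : w - eta *: gradw H w u - (w - eta *: gradPhi0 Q w)
      = - (eta *: (gradw H w u - gradPhi0 Q w)).
    by apply/rowP => i; rewrite !mxE; ring.
  by rewrite enormN enormZ gtr0_norm// ler_pM2l.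
have hA := sqr_avg_gradw_le w u; rewrite -/A in hA.
have hB : enorm (gradw H w u) ^+ 2
    <= 2 * (Lam0 * G w + Lam1) + 2 * (Lu ^+ 2 * X ^+ 2).
  rewrite -{1}(subrK (gradPhi0 Q w) (gradw H w u)) addrC.
  apply: (le_trans (sqr_enormD _ _)); apply: lerD; rewrite ler_pM2l//.
  by rewrite -exprMn ler_pXn2r// nnegrE ?enorm_ge0// mulr_ge0.
rewrite /gradmap_coef /noise_coef /lag_coef.
move: hA hB X0 A0; move: (enorm (gradw H w u) ^+ 2) (G w) => B g hA hB X0 A0.
have T1 : 0 <= Thw + 1 by rewrite addr_ge0.
have h1 : (2 * eta * Lw * A + Lu * X) ^+ 2
    <= 8 * (eta ^+ 2 * Lw ^+ 2) * A ^+ 2 + 2 * Lu ^+ 2 * X ^+ 2.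
  by have := sqr_ge0 (2 * eta * Lw * A - Lu * X); lra.
have eL : 0 <= eta ^+ 2 * Lw ^+ 2 by rewrite mulr_ge0 ?sqr_ge0.
have h2 := ler_wpM2l eL hA.
have h3 := ler_wpM2l eL (ler_wpM2l T1 hB).
have e1 : eta ^+ 2 <= 1 by rewrite expr_le1// ltW.
(* Since [eta <= 1], the factor [eta ^ 2] is dropped here, which makes [lag_coef] independent of the
   step size. *)
have h4 : eta ^+ 2 * (Lw ^+ 2 * ((Thw + 1) * (Lu ^+ 2 * X ^+ 2)))
    <= Lw ^+ 2 * ((Thw + 1) * (Lu ^+ 2 * X ^+ 2)).
  by rewrite ler_piMl// mulr_ge0 ?sqr_ge0// mulr_ge0// mulr_ge0 ?sqr_ge0.
apply: (le_trans h1); rewrite !mulrDr !mulrDl in h2 h3 *.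
lra.
Qed.

(** * Lyapunov decrease per epoch and its telescoped sum *)

Definition lyapunov (s : state (R := R) (p := p) (q := q)) : R :=
  psi (wt s) + eta * lyapunov_weight * enorm (ut s - u0star Q (wt s)) ^+ 2.

Hypothesis eta_gradmap_coef : 64 * eta ^+ 2 * gradmap_coef <= 1.
Hypothesis eta_lag_growth : 8 * eta ^+ 2 * lyapunov_weight * lag_growth <= 1.

Lemma epoch1E (pi : 'S_n) s :
  let: W := (foldl (descent_step Q eta (ascent (wt s) (ut s))) (wt s, evw s)
    [seq pi i | i <- enum 'I_n]).1 in
  epoch Q 1 eta etah pi s = State (prox eta (mf Q) W) (ascent (wt s) (ut s))
    (evw s + n) (evu s + n).
Proof.
rewrite /epoch /= /ascent gradu_mH scalerA.
set u' := prox _ _ _; set l := [seq _ | _ <- _].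
have := foldl_descent_count eta u' (wt s) (evw s) l.
by case: (foldl _ _ l) => W k /= ->; rewrite size_map size_enum_ord.
Qed.

Lemma epoch_decrease (pi : 'S_n) s : edom (mf Q) (wt s) ->
  let s' := epoch Q 1 eta etah pi s in
  [/\ edom (mf Q) (wt s'), evw s' = (evw s + n)%N, evu s' = (evu s + n)%N &
      eta * G (wt s) <= 64 * eta ^+ 3 * noise_coef
        + 32 * (lyapunov s - lyapunov s')].
Proof.
move=> fw; rewrite /= epoch1E /lyapunov /=.
set w := wt s in fw *; set u := ut s; set u' := ascent w u.
set W := (foldl _ _ _).1.
have [e e0 [We e2]] := epoch_error w u' (evw s) pi; rewrite -/W in We.
have [fw' dec] := prox_descent fw e0 We; set w' := prox _ _ W in fw' dec *.
split=> //.
have r01 : 0 <= rho < 1 by rewrite contraction_rate_ge0 contraction_rate_lt1.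
have Xz := ascent_contract w u; rewrite -/u' in Xz.
have z0 : 0 <= enorm (u - u0star Q w) by exact: enorm_ge0.
apply: (lyapunov_step eta_gt0 (sqr_ge0 _) (sqr_ge0 _) lag_coef_ge0
  lyapunov_weight_ge0 dec e2 _ _ _ eta_gradmap_coef eta_lag_growth).
- rewrite ler_pXn2r ?nnegrE ?enorm_ge0//; apply: (le_trans Xz).
  by rewrite ler_piMl//; have /andP[_ /ltW] := r01.
(* The new lag is measured from the maximizer at [w'], which has itself moved by at most
   [kap * enorm (w' - w)]. *)
- rewrite /lag_growth -mulrA -exprMn; apply: le_trans (sqr_convex_le _ _ r01).
  have b0 : 0 <= rho * enorm (u - u0star Q w) + kap * enorm (w' - w).
    by apply: addr_ge0; apply: mulr_ge0; rewrite ?enorm_ge0//;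
       [exact: contraction_rate_ge0|exact: u0star_lip_const_ge0].
  rewrite ler_pXn2r ?nnegrE ?enorm_ge0//.
  apply: (le_trans (enorm_trans _ (u0star Q w) _)); apply: lerD => //.
  by rewrite (enormB w' w); exact: u0star_lip.
- rewrite /lyapunov_weight divfK// gt_eqF// subr_gt0.
  by have /andP[] := r01.
Qed.

Lemma Psi0E w : edom (mf Q) w -> Psi0 Q w = (psi w)%:E.
Proof.
move=> fw; have [[fNy _] _ _] := sa_f sa.
by rewrite /Psi0 EFinD -(edom_fineK fNy fw) Phi0E.
Qed.

Lemma run_bound (pi : nat -> 'S_n) w0 u0 (T : nat) (Delta : R) :
  edom (mf Q) w0 -> (Psi0 Q w0 - Psi0star Q)%E = Delta%:E ->
  let alg := run Q 1 (fun=> eta) (fun=> etah) pi w0 u0 in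
  [/\ eta * \sum_(0 <= t < T) G (wt (alg t)) <=
        T%:R * (64 * eta ^+ 3 * noise_coef)
        + 32 * (Delta + lyapunov_weight * enorm (u0 - u0star Q w0) ^+ 2),
      evw (alg T) = (T * n)%N & evu (alg T) = (T * n)%N].
Proof.
move=> fw0 hDelta alg.
have [fwT -> -> sumT] : [/\ edom (mf Q) (wt (alg T)), evw (alg T) = (T * n)%N,
    evu (alg T) = (T * n)%N &
    eta * \sum_(0 <= t < T) G (wt (alg t)) <= T%:R * (64 * eta ^+ 3 * noise_coef)
      + 32 * (lyapunov (alg 0%N) - lyapunov (alg T))].
  elim: T => [|T [fwT IHw IHu IH]].
    by split=> //; rewrite big_nil mulr0 mul0r subrr mulr0 addr0.
  have [fw' ew eu dec] := epoch_decrease (pi T.+1) fwT.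
  split; [exact: fw'|by rewrite /= ew IHw mulSnr|by rewrite /= eu IHu mulSnr|].
  rewrite big_nat_recr//= mulrDr; apply: (le_trans (lerD IH dec)).
  rewrite -addn1 natrD mulrDl mul1r -/(alg T); move: (lyapunov _) (lyapunov _) => x y.
  lra.
split=> //; apply: (le_trans sumT); rewrite lerD2l ler_pM2l//.
(* [hDelta] excludes the infimum [+oo] and [sa_Psi0] excludes [-oo], so the comparison takes place
   between reals. *)
have psiT : psi w0 - psi (wt (alg T)) <= Delta.
  have : (Psi0star Q <= Psi0 Q (wt (alg T)))%E.
    by apply: ereal_inf_lbound; exists (wt (alg T)).
  have := sa_Psi0 sa; move: hDelta; rewrite !Psi0E//.
  by case: (Psi0star Q) => // r [<-] _; rewrite lee_fin; lra.
rewrite /lyapunov /= in psiT *.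
have hl := lyapunov_weight_ge0.
have h1 : eta * lyapunov_weight * enorm (u0 - u0star Q w0) ^+ 2
    <= lyapunov_weight * enorm (u0 - u0star Q w0) ^+ 2.
  by rewrite -mulrA ler_piMl// mulr_ge0// sqr_ge0.
have h2 : 0 <= eta * lyapunov_weight
    * enorm (ut (alg T) - u0star Q (wt (alg T))) ^+ 2.
  by apply: mulr_ge0 (sqr_ge0 _); apply: mulr_ge0 => //; exact: ltW.
move: psiT h1 h2; move: (fine _) (fine _) (fine _) (fine _) => a b c f.
move: (_ * _ * _) (_ * _) (_ * _ * _) => x y z.
lra.
Qed.

End Problem.

(** * Choice of the constants and evaluation count *)

Theorem theorem2 (R : realType) :
  exists2 K : R, 0 < K &
  forall (Lw Lu muH muh Thw sgw Lam0 Lam1 etah Delta D : R),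
    0 <= Lw -> 0 <= Lu -> 0 <= muH -> 0 <= muh -> 0 < muH + muh ->
    0 <= Thw -> 0 <= sgw -> 1 <= Lam0 -> 0 <= Lam1 ->
    0 < etah <= 2 / (Lu + muH) ->
  exists (S : nat) (c C M eps0 : R),
    [/\ (0 < S)%N,
        S%:R <= K * (etah^-1 * (muh + 4 * Lu * muH / (Lu + muH))^-1) + 1,
        0 < c, 0 < C & 0 < eps0] /\
  forall (n p q : nat) (Q : minimax R n p q) (Thu sgu : R)
    (w0 : 'rV[R]_p) (u0 : 'rV[R]_q),
    0 <= Thu -> 0 <= sgu ->
    standing_assumptions Q Lw Lu muH muh Thw sgw Thu sgu ->
    edom (mf Q) w0 -> edom (mh Q) u0 ->
    (Psi0 Q w0 - Psi0star Q)%E = Delta%:E ->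
    enorm (u0 - u0star Q w0) = D ->
  forall eps : R, 0 < eps < eps0 ->
    let eta := c * eps in
    let T := `|Num.ceil (C / eps ^+ 3)|%N in
    (forall w : 'rV[R]_p,
       enorm (gradPhi0 Q w) ^+ 2 <= Lam0 * enorm (gradmap Q eta w) ^+ 2 + Lam1) ->
  forall pi : nat -> 'S_n,
    let alg := run Q S (fun=> eta) (fun=> etah) pi w0 u0 in
    let normG := fun t : nat => enorm (gradmap Q eta (wt (alg t))) in
    [/\ T.+1%:R^-1 * \sum_(0 <= t < T.+1) normG t ^+ 2 <= eps ^+ 2,
        (evw (alg T))%:R <= M * (n%:R / eps ^+ 3),
        (evu (alg T))%:R <= M * (n%:R / eps ^+ 3) &
        forall (d : measure_display) (Omega : measurableType d)
          (P : probability Omega R) (tstar : Omega -> nat),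
          output_rule P T normG tstar ->
          ('E_P[(fun om => normG (tstar om) ^+ 2)%R] <= (eps ^+ 2)%:E)%E].
Proof.
exists 1 => // Lw Lu muH muh Thw sgw Lam0 Lam1 etah Delta D.
move=> Lw0 Lu0 muH0 muh0 mu0 Thw0 sgw0 Lam01 Lam10 /andP[etah0 etah_le].
pose rho := contraction_rate muH muh etah.
pose LP := Phi_smooth_const Lw Lu muH muh etah.
pose P := gradmap_coef Lw Thw Lam0.
pose B := noise_coef Lw Thw sgw Lam1.
pose lam := lyapunov_weight Lw Lu muH muh Thw etah.
pose k := lag_growth Lw muH muh etah.
have Lam00 : 0 <= Lam0 by rewrite (le_trans ler01).
have T1 : 0 <= Thw + 1 by rewrite addr_ge0.
have LP0 : 0 <= LP by exact: Phi_smooth_const_ge0.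
have lam0 : 0 <= lam by exact: lyapunov_weight_ge0.
have k0 : 0 <= k.
  apply: mulr_ge0 (sqr_ge0 _); rewrite invr_ge0 subr_ge0 ltW//.
  exact: contraction_rate_lt1.
have P0 : 0 <= P by rewrite mulr_ge0// mulr_ge0// mulr_ge0// sqr_ge0.
have B0 : 0 <= B.
  by apply: addr_ge0; [rewrite mulr_ge0// mulr_ge0// mulr_ge0// sqr_ge0
                      |rewrite mulr_ge0 ?sqr_ge0// mulr_ge0// sqr_ge0].
have lk0 : 0 <= lam * k by exact: mulr_ge0.
(* The first four bounds on [c] are the step-size conditions of [run_bound]; the fifth halves the
   noise budget in [avg_le_sqr]. *)
have [|||||c /andP[c0 c1] [cLw cLP clk cP cB]] :=
    @small_step R (2 * Lw) (2 * LP) (8 * (lam * k)) (64 * P) (128 * B);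
  do ?exact: mulr_ge0.
pose D0 := Delta + lam * D ^+ 2.
(* [Delta] is an arbitrary real at this point, hence the absolute value; adding 1 keeps [C] positive
   when [D0 = 0]. *)
pose C := 64 * `|D0| / c + 1.
have C0 : 0 < C by rewrite ltr_wpDl// divr_ge0 ?mulr_ge0// ltW.
have cC : 64 * D0 <= c * C.
  have -> : c * C = 64 * `|D0| + c by rewrite /C mulrDr mulr1 mulrC divfK// gt_eqF.
  by have := ler_norm D0; lra.
(* [M = C + 1] pays for rounding up the number of epochs, since [1 <= eps ^ -3] for [eps < 1]. *)
clearbody C; exists 1%N, c, C, (C + 1), 1; split.
  split=> //.
  rewrite mul1r lerDr mulr_ge0 ?invr_ge0 ?(ltW etah0)//.
  by rewrite addr_ge0// divr_ge0 ?addr_ge0// !mulr_ge0.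
move=> n p q Q Thu sgu w0 u0 Thu0 sgu0 sa fw0 hu0 hDelta hD eps /andP[eps0 eps1].
move=> eta T hLam pi alg normG.
have eta0 : 0 < eta by exact: mulr_gt0.
have etac : eta <= c by rewrite ler_piMr ?ltW.
have eta1 : eta <= 1 by exact: le_trans c1.
have etax (x : R) : 0 <= x -> eta * x <= c * x by move=> x0; rewrite ler_wpM2r.
have eta2x (x : R) : 0 <= x -> eta ^+ 2 * x <= c * x.
  move=> x0; apply: le_trans (etax x x0); rewrite ler_wpM2r// expr2.
  by rewrite ler_piMr// ltW.
have e3 : 0 < eps ^+ 3 by rewrite exprn_gt0.
have x0 : 0 <= C / eps ^+ 3 by rewrite divr_ge0 ?ltW.
have TE : T%:R = (Num.ceil (C / eps ^+ 3))%:~R :> R.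
  by rewrite /T natr_absz ger0_norm// ceil_ge0 (lt_le_trans _ x0)// ltrN10.
have TC : C / eps ^+ 3 <= T%:R by rewrite TE ceil_ge.
have CT : T%:R <= C / eps ^+ 3 + 1.
  have /andP[hc _] := ceil_itv (C / eps ^+ 3).
  by move: hc; rewrite TE intrB ltrBlDr => /ltW.
have eta_Lw : 2 * (eta * Lw) <= 1.
  by rewrite mulrCA; apply: le_trans cLw; apply: etax; exact: mulr_ge0.
have eta_LP : 2 * (eta * LP) <= 1.
  by rewrite mulrCA; apply: le_trans cLP; apply: etax; exact: mulr_ge0.
have eta_P : 64 * eta ^+ 2 * P <= 1.
  have -> : 64 * eta ^+ 2 * P = eta ^+ 2 * (64 * P) by rewrite [64 * _]mulrC mulrA.
  by apply: le_trans cP; apply: eta2x; exact: mulr_ge0.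
have eta_lk : 8 * eta ^+ 2 * lam * k <= 1.
  have -> : 8 * eta ^+ 2 * lam * k = eta ^+ 2 * (8 * (lam * k)).
    by rewrite [8 * _]mulrC !mulrA.
  by apply: le_trans clk; apply: eta2x; exact: mulr_ge0.
have c2B : 128 * c ^+ 2 * B <= 1.
  have -> : 128 * c ^+ 2 * B = c ^+ 2 * (128 * B) by rewrite [128 * _]mulrC mulrA.
  apply: le_trans cB.
  by rewrite ler_wpM2r ?mulr_ge0// expr2 ler_piMr// ltW.
have bound := run_bound sa Lw0 Lu0 muH0 muh0 etah0 etah_le mu0 Thw0 eta0 eta1
  eta_Lw eta_LP hLam eta_P eta_lk pi u0 _ fw0 hDelta.
have avg : T.+1%:R^-1 * \sum_(0 <= t < T.+1) normG t ^+ 2 <= eps ^+ 2.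
  (* The average includes the final iterate, so the telescoped bound is taken over [T + 1] epochs,
     while the evaluation count below stops at [T]. *)
  have [hsum _ _] := bound T.+1; rewrite hD in hsum.
  apply: (avg_le_sqr c0 eps0 _ c2B (D0 := D0) (C := C) _ _ hsum).
  - by rewrite ltr0n.
  - exact: cC.
  - by rewrite (le_trans TC)// ler_nat.
have count : (T * n)%:R <= (C + 1) * (n%:R / eps ^+ 3).
  rewrite natrM mulrA mulrAC ler_wpM2r// (le_trans CT)// mulrDl lerD2l mul1r.
  by rewrite -invr1 lef_pV2 ?posrE// exprn_ile1// ltW.
have [_ ew eu] := bound T.
split; [exact: avg|by rewrite ew|by rewrite eu|].
move=> d Omega Pr tstar rule.
exact: (output_rule_expectation (fun t => enorm_ge0 _) rule avg).
Qed.
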